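(* Assume: (consistency) $Y=Y(A)$; (latent ignorability) for any $a\in\mathcal{A}$, $Y(a)$ is conditionally independent of $\{A,Z\}$ given $(U,L)$; (IV independence) $Z$ is conditionally independent of $U$ given $L$; (IV relevance) for any $a\in\mathcal{A}$ and $l\in\mathcal{L}$, $Z$ and $I\{A=a\}$ are not conditionally independent given $L=l$, i.e. there exist two distinct $z_0,z_1\in\mathcal{Z}$ with $\Pr(A=a\mid Z=z_0,L=l)\neq\Pr(A=a\mid Z=z_1,L=l)$. Let $a\in\mathcal{A}$, $A^{(a)}:=I\{A=a\}$, and assume that $Z$ is a multiplicative IV for $A=a$ and that $\pi(Z,L)$ is a regular weighting function for $A=a$. Then there exists a unique solution $f_a^o(A^{(a)},L)$ to $$\mathbb{E}[A^{(a)}Y\mid Z,L]=\mathbb{E}[f_a^o(A^{(a)},L)\mid Z,L],$$ and it has the explicit form $$f_a^o(0,L)=\mathbb{E}[Y(a)\mid L]-\mathbb{E}[Y(a)\mid L,A\neq a],\qquad f_a^o(1,L)=\mathbb{E}[Y(a)\mid L].$$ In particular, for any regular weighting function $\pi(Z,L)$ for $A=a$, $$\mathbb{E}[Y(a)]=\psi_{a,MIV}^o:=\mathbb{E}\left[(1-A^{(a)})\frac{\mathrm{Cov}\{A^{(a)}Y,\pi(Z,L)\mid L\}}{\mathrm{Cov}\{A^{(a)},\pi(Z,L)\mid L\}}+A^{(a)}Y\right].$$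
   Context: $A\in\mathcal{A}=\{0,\dots,M\}$ is a treatment, $Z\in\mathcal{Z}\subseteq\mathbb{R}^{d_Z}$ an instrument (multi-categorical or continuous), $U$ unmeasured confounders, $L\in\mathcal{L}\subseteq\mathbb{R}^{d_L}$ observed covariates, $Y\in\mathbb{R}$ the observed outcome, $Y(a)$ the potential outcome at treatment level $a$. $Z$ is a multiplicative IV for $A=a$ if there exist functions $b(U,L)$ and $c(Z,L)$ such that $\Pr(A\neq a\mid Z,U,L)=b(U,L)\,c(Z,L)$. $\pi(Z,L)$ is a regular weighting function for $A=a$ if it is uniformly bounded and there exists $\epsilon_0>0$ with $|\mathrm{Cov}\{I\{A=a\},\pi(Z,L)\mid L\}|\ge\epsilon_0$ uniformly for all $L$. Equalities between random variables are almost sure; the moments involved are assumed to exist. *)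

(* Defs.v *)
From HB Require Import structures.
From mathcomp Require Import all_boot all_order all_algebra.
From mathcomp Require Import all_classical all_reals all_analysis measurable_realfun.

Set Implicit Arguments.
Unset Strict Implicit.
Unset Printing Implicit Defensive.

Import Order.TTheory GRing.Theory Num.Theory.
Import numFieldNormedType.Exports.

Local Open Scope classical_set_scope.
Local Open Scope ring_scope.

(* The finite set {0, ..., M} carries the discrete sigma-algebra. *)
HB.instance Definition _ (M : nat) := isPointed.Build 'I_M.+1 ord0.
HB.instance Definition _ (M : nat) := @isMeasurable.Build
  default_measure_display 'I_M.+1 discrete_measurable discrete_measurable0
  discrete_measurableC discrete_measurableU.

Section conditioning.
Context d (T : measurableType d) (R : realType) (P : probability T R).
Context d' (S : measurableType d') (W : T -> S).

(* [g] is a version of w |-> E[X | W = w]: [g \o W] is integrable and satisfies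
   the defining identity of E[X | W] on every event of the sigma-algebra
   generated by W.  Such a g is unique up to null sets of the law of W. *)
Definition is_regression (X : T -> R) (g : S -> R) : Prop :=
  [/\ measurable_fun [set: S] g,
      P.-integrable [set: T] (EFin \o (g \o W)) &
      forall B, measurable B ->
        (\int[P]_(t in W @^-1` B) (g (W t))%:E =
         \int[P]_(t in W @^-1` B) (X t)%:E)%E].

Definition regression (X : T -> R) : S -> R :=
  xget (cst 0) [set g | is_regression X g].

Definition cond_exp (X : T -> R) : T -> R := regression X \o W.

Definition cond_prob (E : set T) : T -> R := cond_exp \1_E.

Definition cond_cov (X Y : T -> R) : T -> R :=
  cond_exp (fun t => (X t - cond_exp X t) * (Y t - cond_exp Y t)).

Definition cond_indep d1 (S1 : measurableType d1) d2 (S2 : measurableType d2)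
    (X1 : T -> S1) (X2 : T -> S2) : Prop :=
  forall B1 B2, measurable B1 -> measurable B2 ->
    {ae P, forall t, cond_prob (X1 @^-1` B1 `&` X2 @^-1` B2) t =
      cond_prob (X1 @^-1` B1) t * cond_prob (X2 @^-1` B2) t}.

End conditioning.

(* E[X | W, E] as a function of W: the value of E[X | 1_E, W] at 1_E = 1.  It is
   determined almost surely on {Pr(E | W) > 0}. *)
Definition cond_exp_on d (T : measurableType d) (R : realType)
    (P : probability T R) d' (S : measurableType d') (W : T -> S)
    (E : set T) (X : T -> R) : T -> R :=
  fun t => regression P (fun s => (s \in E, W s)) X (true, W t).

Lemma regressionP d (T : measurableType d) (R : realType)
    (P : probability T R) d' (S : measurableType d') (W : {mfun T >-> S})
    (X : T -> R) :
  P.-integrable [set: T] (EFin \o X) -> is_regression P W X (regression P W X).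
Proof.
move=> iX; apply: xgetPex.
have mX := measurable_int _ iX.
have mW : measurable_fun [set: T] W by [].
have mpre B : measurable B -> measurable (W @^-1` B).
  by move=> mB; rewrite -[X in measurable X]setTI; exact: mW.
pose nu : {charge set S -> \bar R} :=
  measure_function_pushforward__canonical__charge_Charge (induced_charge iX) mW.
have nuE B : nu B = (\int[P]_(t in W @^-1` B) (X t)%:E)%E by [].
have numu : nu `<< distribution P W.
  apply/null_content_dominatesP => B mB PB; rewrite nuE.
  apply: null_set_integral => //; first exact: mpre.
  by apply: (measurable_funS measurableT _ mX).
pose g := Radon_Nikodym nu (distribution P W).
have gfin y : g y \is a fin_num by exact: Radon_Nikodym_fin_num.
have ig : (distribution P W).-integrable [set: S] g.
  exact: Radon_Nikodym_integrable.
have mg : measurable_fun [set: S] g by exact: (measurable_int _ ig).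
have EFg : EFin \o (fine \o g) = g by apply/funext => y /=; rewrite fineK.
have igW : P.-integrable [set: T] (g \o W).
  apply/integrableP; split; first by apply: measurableT_comp.
  have /integrableP[_] := ig.
  by rewrite ge0_integral_distribution//; apply: (measurableT_comp _ mg).
exists (fine \o g); split.
- exact: (measurableT_comp _ mg).
- by rewrite compA EFg.
- move=> B mB; rewrite -nuE.
  rewrite (Radon_Nikodym_integral numu mB) integral_pushforward//.
  + by apply: eq_integral => t _ /=; rewrite fineK.
  + by apply: integrableS igW => //; exact: mpre.
Qed.

Section multiplicative_iv.
Context d (Omega : measurableType d) (R : realType) (P : probability Omega R).
Context dA (SA : measurableType dA) dZ (SZ : measurableType dZ).
Context dL (SL : measurableType dL) dU (SU : measurableType dU).
Context (supZ : set SZ) (supL : set SL).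
Context (A : Omega -> SA) (Z : Omega -> SZ) (L : Omega -> SL) (U : Omega -> SU).

Definition treated (a : SA) : Omega -> R := \1_[set w | A w = a].

(* Pr(A = a | Z = z, L = l) is only determined up to null sets, so the
   condition is required of every version [p] of it, for almost every l.  For a
   single version, even at every l, it could be met by an irrelevant instrument
   after changing [p] on a null set; required of all versions, it says that Z
   and I{A = a} are not conditionally independent given L = l. *)
Definition iv_relevance : Prop :=
  forall (a : SA) (p : SZ * SL -> R),
    is_regression P (fun w => (Z w, L w)) (treated a) p ->
    {ae pushforward P L, forall l, supL l -> exists z0 z1,
      [/\ supZ z0, supZ z1, z0 <> z1 & p (z0, l) <> p (z1, l)]}.

Definition multiplicative_iv (a : SA) : Prop :=
  exists (b : SU * SL -> R) (c : SZ * SL -> R),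
    [/\ measurable_fun [set: SU * SL] b, measurable_fun [set: SZ * SL] c &
        {ae P, forall w,
          cond_prob P (fun w => (Z w, U w, L w)) [set w | A w <> a] w =
          b (U w, L w) * c (Z w, L w)}].

Definition regular_weighting (a : SA) (piw : SZ * SL -> R) : Prop :=
  [/\ measurable_fun [set: SZ * SL] piw,
      exists C : R, forall z l, supZ z -> supL l -> `|piw (z, l)| <= C &
      exists2 eps0 : R, 0 < eps0 & {ae P, forall w,
        eps0 <= `|cond_cov P L (treated a) (fun w => piw (Z w, L w)) w|}].

End multiplicative_iv.

(* Main.v *)
Require Import Defs.
From HB Require Import structures.
From mathcomp Require Import all_boot all_order all_algebra.
From mathcomp Require Import all_classical all_reals all_analysis measurable_realfun.
From mathcomp Require Import ring lra.

Import Order.TTheory GRing.Theory Num.Theory.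
Import numFieldNormedType.Exports.

Local Open Scope classical_set_scope.
Local Open Scope ring_scope.

(* Write X = Y(a), A0 = I{A <> a}, p0 = E[A0 | Z, L], m = E[X | L] and
   n = E[X | L, A <> a].  Latent ignorability gives
   E[A0 X | Z, U, L] = b(U, L) c(Z, L) E[X | U, L], and since Z and U are
   independent given L, averaging over U yields
   E[A0 X | Z, L] = c E[b E[X | U, L] | L], while p0 = c E[b | L].  Hence
   E[A0 X | Z, L] = rho(L) p0 for some rho; conditioning on L identifies rho
   with n, as E[A0 | L] > 0.  Together with E[X | Z, L] = m this reads
   E[A Y | Z, L] = m - n p0 = E[m - n A0 | Z, L], which is the solution.
   If d(A, L) has zero regression on (Z, L), then multiplying it by
   pi - E[pi | L] and conditioning on L gives
   (d(1, L) - d(0, L)) Cov(A, pi | L) = 0, whence uniqueness; the same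
   computation shows that the ratio of covariances in psi is n.
   The factors b and c need not be integrable: weights of the form 1 / (1 + |x|)
   make every conditional expectation involved finite. *)

Set Implicit Arguments.
Unset Strict Implicit.
Unset Printing Implicit Defensive.

(** * Real-valued integrable functions *)

(** Real powers are measurable, but [powR] agrees with the inverse only on nonnegative reals, hence
    the detour through the square. At 0 both sides are 0 because [0^-1 = 0]. *)
Lemma measurable_invr (R : realType) : measurable_fun [set: R] (@GRing.inv R).
Proof.
have -> : @GRing.inv R = fun x => x * (x ^+ 2) `^ (-1).
  apply/funext => x; rewrite powR_inv1 ?sqr_ge0// expr2 invfM mulrA.
  by have [->|x0] := eqVneq x 0; rewrite ?invr0 ?mul0r ?mulr0// divff// mul1r.
apply: measurable_funM => //.
apply: (measurableT_comp (measurable_powR (-1))) => /=.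
exact: exprn_measurable.
Qed.

(** A positive weight at most 1 for which [damping x * x] is also at most 1 in absolute value.
    Multiplying by it makes a factor bounded, and being nonzero it can be cancelled afterwards. *)
Definition damping (R : realType) (x : R) : R := (1 + `|x|)^-1.

Section damping.
Context (R : realType).
Implicit Types x : R.

Lemma damping_gt0 x : 0 < damping x.
Proof. by rewrite invr_gt0 ltr_pwDl. Qed.

Lemma damping_neq0 x : damping x != 0.
Proof. by rewrite gt_eqF// damping_gt0. Qed.

Lemma normr_damping x : `|damping x| <= 1.
Proof. by rewrite gtr0_norm ?damping_gt0// invf_le1 ?ltr_pwDl// lerDl. Qed.

Lemma normr_dampingM x : `|damping x * x| <= 1.
Proof.
by rewrite normrM gtr0_norm ?damping_gt0// mulrC ler_pdivrMr ?ltr_pwDl// mul1r lerDr.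
Qed.

Lemma measurable_damping : measurable_fun [set: R] (@damping R).
Proof.
apply: continuous_measurable_fun => x; apply: cvgV.
  by rewrite gt_eqF// ltr_pwDl.
by apply: cvgD; [exact: cvg_cst|exact: norm_continuous].
Qed.

End damping.

Section integrable_real.
Context d (T : measurableType d) (R : realType) (P : probability T R).
Implicit Types F G h : T -> R.
Local Notation L1 F := (P.-integrable [set: T] (EFin \o F)).

Lemma integrable_measurable F : L1 F -> measurable_fun [set: T] F.
Proof. by move=> /measurable_int/measurable_EFinP. Qed.

Lemma integrable_real_ae F G : L1 F -> measurable_fun [set: T] G ->
  {ae P, forall t, F t = G t} -> L1 G.
Proof.
move=> /integrableP[mF iF] mG FG.
have mG' : measurable_fun [set: T] (EFin \o G) by exact/measurable_EFinP.
apply/integrableP; split=> //.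
rewrite (@ae_eq_integral _ _ _ P setT (abse \o (EFin \o F)))//.
- exact: measurableT_comp.
- exact: measurableT_comp.
- by apply: filterS FG => t FGt _ /=; rewrite FGt.
Qed.

Lemma integrable_realD F G : L1 F -> L1 G -> L1 (fun t => F t + G t).
Proof. by move=> iF iG; exact: (integrableD measurableT iF iG). Qed.

Lemma integrable_realB F G : L1 F -> L1 G -> L1 (fun t => F t - G t).
Proof. by move=> iF iG; exact: (integrableB measurableT iF iG). Qed.

Lemma integrable_bounded_mul h F C : measurable_fun [set: T] h ->
  {ae P, forall t, `|h t| <= C} -> L1 F -> L1 (fun t => h t * F t).
Proof.
move=> mh hC iF; have mF := integrable_measurable iF.
(* The bound on [h] holds only almost surely; clamping [h] to the interval from [- |C|] to [|C|]
   gives an everywhere bounded function that agrees with [h] almost surely. *)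
pose k := fun t => Num.max (- `|C|) (Num.min `|C| (h t)).
have mk : measurable_fun [set: T] k.
  by apply: measurable_maxr => //; exact: measurable_minr.
apply: (@integrable_real_ae (fun t => k t * F t)).
- apply: (@integrableMr _ _ _ P _ measurableT k (EFin \o F)) => //.
  exists `|C|; split=> // M CM t _ /=; apply: le_trans (ltW CM).
  by rewrite /k ler_norml le_max lexx /= ge_max ge_min lexx /= ge0_cp.
- exact: measurable_funM.
- apply: filterS hC => t hC; congr (_ * _).
  have /ler_normlP[] := le_trans hC (ler_norm C).
  rewrite /k lerNl => h1 h2.
  by rewrite min_r// max_r.
Qed.

Lemma integrable_bounded h C : measurable_fun [set: T] h ->
  {ae P, forall t, `|h t| <= C} -> L1 h.
Proof.
move=> mh hC.
have i1 : L1 (cst (1 : R)) by exact: finite_measure_integrable_cst.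
have := integrable_bounded_mul mh hC i1.
by under eq_fun do rewrite mulr1.
Qed.

Lemma integrable_indicR (E : set T) : measurable E -> L1 (\1_E : T -> R).
Proof. by move=> mE; apply: integrable_indic => //=; rewrite -ge0_fin_numE. Qed.

Lemma integrable_mul_indic F (E : set T) :
  L1 F -> measurable E -> L1 (fun t => F t * \1_E t).
Proof.
move=> iF mE; have -> : (fun t => F t * \1_E t) = (fun t => \1_E t * F t).
  by apply/funext => t; rewrite mulrC.
apply: (@integrable_bounded_mul _ _ 1) => //.
by apply: aeW => t; rewrite indicE; case: (_ \in _); rewrite ?normr1 ?normr0.
Qed.

Lemma integral_indicM (E : set T) F : measurable E ->
  (\int[P]_(t in E) (F t)%:E = \int[P]_t (\1_E t * F t)%:E)%E.
Proof.
move=> mE; rewrite integral_mkcond; apply: eq_integral => t _ /=.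
by rewrite patchE indicE; case: (t \in E); rewrite ?mul1r ?mul0r.
Qed.

Lemma eq_integral_ae (E : set T) F G : measurable E ->
  measurable_fun [set: T] F -> measurable_fun [set: T] G ->
  {ae P, forall t, F t = G t} ->
  (\int[P]_(t in E) (F t)%:E = \int[P]_(t in E) (G t)%:E)%E.
Proof.
move=> mE mF mG FG; apply: ae_eq_integral => //.
- by apply: measurable_funTS; exact/measurable_EFinP.
- by apply: measurable_funTS; exact/measurable_EFinP.
- by apply: filterS FG => t -> .
Qed.

(** On the set where [F] is positive its integral is that of its absolute value, so it is both
    nonnegative and nonpositive. Hence [F] vanishes almost surely on a set where it is positive. *)
Lemma ae_le0 F : L1 F ->
  (\int[P]_(t in [set t | 0 < F t]%R) (F t)%:E <= 0)%E ->
  {ae P, forall t, F t <= 0}.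
Proof.
move=> iF; have mF := integrable_measurable iF.
set E := [set t | _].
have mE : measurable E.
  rewrite (_ : E = [set: T] `&` F @^-1` `]0, +oo[%classic); first exact: mF.
  by apply/seteqP; split=> t /=; rewrite in_itv/= andbT => // -[].
have mFE : measurable_fun E (EFin \o F).
  by apply: measurable_funTS; exact/measurable_EFinP.
move=> FE0.
have : (\int[P]_(t in E) `|(EFin \o F) t| = 0)%E.
  apply/eqP; rewrite eq_le integral_ge0// andbT; apply: le_trans FE0.
  rewrite le_eqVlt; apply/orP; left; apply/eqP; apply: eq_integral => t.
  by rewrite inE /E /= => F0; rewrite ger0_norm// ltW.
move/(ae_eq_integral_abs _ mE mFE); apply: filterS => t /= FE.
rewrite leNgt; apply/negP => F0; have [F0'] := FE F0.
by rewrite F0' ltxx in F0.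
Qed.

End integrable_real.

(** * Regression functions *)

Section regression_theory.
Context d (T : measurableType d) (R : realType) (P : probability T R).
Context d' (S : measurableType d') (W : T -> S).
Hypothesis mW : measurable_fun [set: T] W.
Implicit Types (X Y : T -> R) (g phi : S -> R).
Local Notation L1 F := (P.-integrable [set: T] (EFin \o F)).

Lemma measurable_preimage B : measurable B -> measurable (W @^-1` B).
Proof. by move=> mB; rewrite -[X in measurable X]setTI; exact: mW. Qed.

Lemma measurable_comp_real g :
  measurable_fun [set: S] g -> measurable_fun [set: T] (fun t => g (W t)).
Proof. by move=> mg; exact: measurableT_comp. Qed.

Lemma regression_exists X : L1 X -> is_regression P W X (regression P W X).
Proof.
pose W' : {mfun T >-> S} := mfun_Sub (mem_set mW).
exact: (@regressionP _ _ _ P _ _ W').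
Qed.

Lemma measurable_regression X : measurable_fun [set: S] (regression P W X).
Proof.
(* If no version exists, [xget] returns its default [cst 0], which is measurable too. *)
rewrite /regression; case: xgetP => [g _ []//|_]; exact: measurable_cst.
Qed.

(** Test the defining identities on the event [B] where [g] exceeds [h]: there [g - h] integrates to
    the same value as [X - Y], which is nonpositive, so [ae_le0] applies. *)
Lemma regression_le X Y g h : is_regression P W X g -> is_regression P W Y h ->
  L1 X -> L1 Y -> {ae P, forall t, X t <= Y t} ->
  {ae P, forall t, g (W t) <= h (W t)}.
Proof.
move=> [mg ig gX] [mh ih hY] iX iY XY.
have [mX mY] := (integrable_measurable iX, integrable_measurable iY).
pose B := [set s | 0 < g s - h s].
have mB : measurable B.
  rewrite (_ : B = [set: S] `&` (fun s => g s - h s) @^-1` `]0, +oo[%classic).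
    exact: measurable_funB.
  by apply/seteqP; split=> t /=; rewrite in_itv/= andbT => // -[].
have mWB := measurable_preimage mB.
have sub F : L1 F -> P.-integrable (W @^-1` B) (EFin \o F).
  by move=> iF; exact: integrableS iF.
have : {ae P, forall t, g (W t) - h (W t) <= 0}.
  apply: ae_le0; first exact: integrable_realB.
  have -> : [set t | 0 < g (W t) - h (W t)] = W @^-1` B by [].
  under eq_integral do rewrite EFinB.
  rewrite integralB_EFin//; [|exact: (sub _ ig)|exact: (sub _ ih)].
  rewrite gX// hY//.
  (* Monotonicity of the integral asks for a pointwise inequality, so [Y] is replaced by the almost
     surely equal [max(X, Y)]. *)
  have mM : measurable_fun [set: T] (fun t => Num.max (X t) (Y t)).
    exact: measurable_maxr.
  have YM : {ae P, forall t, Y t = Num.max (X t) (Y t)}.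
    by apply: filterS XY => t XY; rewrite max_r.
  rewrite (eq_integral_ae mWB mY mM YM) sube_le0.
  apply: le_integral => //; first exact: sub.
  + by apply: sub; exact: integrable_real_ae iY mM YM.
  + by move=> t _; rewrite lee_fin le_max lexx.
by apply: filterS => t; rewrite subr_le0.
Qed.

Lemma regression_unique X g h : L1 X ->
  is_regression P W X g -> is_regression P W X h ->
  {ae P, forall t, g (W t) = h (W t)}.
Proof.
move=> iX rg rh.
have XX : {ae P, forall t, X t <= X t} by apply: aeW.
have gh := regression_le rg rh iX iX XX.
have hg := regression_le rh rg iX iX XX.
by apply: filterS2 gh hg => t gh hg; apply/eqP; rewrite eq_le gh.
Qed.

Lemma is_regression_ae X Y g : L1 X -> measurable_fun [set: T] Y ->
  {ae P, forall t, X t = Y t} -> is_regression P W X g -> is_regression P W Y g.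
Proof.
move=> /integrable_measurable mX mY XY [mg ig gX]; split=> // B mB.
by rewrite gX//; apply: eq_integral_ae => //; exact: measurable_preimage.
Qed.

Lemma is_regression_ext X g h : measurable_fun [set: S] h ->
  {ae P, forall t, g (W t) = h (W t)} ->
  is_regression P W X g -> is_regression P W X h.
Proof.
move=> mh gh [mg ig gX]; split=> //.
- by apply: integrable_real_ae ig _ gh; exact: measurable_comp_real.
- move=> B mB; rewrite -gX//.
  apply: eq_integral_ae; [exact: measurable_preimage|exact: measurable_comp_real| |].
  + exact: measurable_comp_real.
  + by apply: filterS gh => t ->.
Qed.

Lemma is_regressionB X Y g h : L1 X -> L1 Y ->
  is_regression P W X g -> is_regression P W Y h ->
  is_regression P W (fun t => X t - Y t) (fun s => g s - h s).
Proof.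
move=> iX iY [mg ig gX] [mh ih hY]; split; first exact: measurable_funB.
  exact: integrable_realB.
move=> B mB; have mWB := measurable_preimage mB.
have sub F : L1 F -> P.-integrable (W @^-1` B) (EFin \o F).
  by move=> iF; exact: integrableS iF.
under eq_integral do rewrite EFinB.
under [RHS]eq_integral do rewrite EFinB.
rewrite !integralB_EFin ?gX ?hY//; by [exact: sub|exact: (sub _ ig)|exact: (sub _ ih)].
Qed.

Lemma is_regressionD X Y g h : L1 X -> L1 Y ->
  is_regression P W X g -> is_regression P W Y h ->
  is_regression P W (fun t => X t + Y t) (fun s => g s + h s).
Proof.
move=> iX iY [mg ig gX] [mh ih hY]; split; first exact: measurable_funD.
  exact: integrable_realD.
move=> B mB; have mWB := measurable_preimage mB.
have sub F : L1 F -> P.-integrable (W @^-1` B) (EFin \o F).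
  by move=> iF; exact: integrableS iF.
under eq_integral do rewrite EFinD.
under [RHS]eq_integral do rewrite EFinD.
rewrite (integralD_EFin _ (sub _ ig) (sub _ ih))//.
by rewrite (integralD_EFin _ (sub _ iX) (sub _ iY))//= gX// hY.
Qed.

Lemma is_regression_id g : measurable_fun [set: S] g -> L1 (g \o W) ->
  is_regression P W (fun t => g (W t)) g.
Proof. by []. Qed.

Lemma regression_bounded X g C : is_regression P W X g ->
  measurable_fun [set: T] X ->
  {ae P, forall t, `|X t| <= C} -> {ae P, forall t, `|g (W t)| <= C}.
Proof.
move=> rg mX XC.
have icst c : L1 (cst c) by exact: finite_measure_integrable_cst.
have rcst (c : R) : is_regression P W (cst c) (cst c).
  by apply: is_regression_id; [exact: measurable_cst|exact: icst].
have iX := integrable_bounded mX XC.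
have h1 : {ae P, forall t, g (W t) <= C}.
  apply: (regression_le rg (rcst C)) => //.
  by apply: filterS XC => t /ler_normlP[].
have h2 : {ae P, forall t, - C <= g (W t)}.
  apply: (regression_le (rcst (- C)) rg) => //.
  by apply: filterS XC => t /ler_normlP[]; rewrite lerNl.
by apply: filterS2 h1 h2 => t g1 g2; rewrite ler_norml g1 g2.
Qed.

(** * Pulling a function of the conditioning variable out of a regression *)

Import HBNNSimple.

(** A simple function of [W] is a finite combination of indicators of events of [W], and [X]
    integrates to zero over each of them. *)
Lemma integral_nnsfun_eq0 X (f : {nnsfun S >-> R}) : L1 X ->
  (forall B, measurable B -> \int[P]_(t in W @^-1` B) (X t)%:E = 0)%E ->
  (\int[P]_t (f (W t) * X t)%:E = 0)%E.
Proof.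
move=> iX X0.
have mf r : measurable (f @^-1` [set r]) by exact: measurable_funPTI.
have mWf r := measurable_preimage (mf r).
have iF r : L1 (fun t => \1_(f @^-1` [set r]) (W t) * X t).
  apply: (@integrable_bounded_mul _ _ _ _ _ _ 1) => //.
  - by apply: (measurableT_comp _ mW); exact: measurable_indic.
  - by apply: aeW => t; rewrite indicE; case: (_ \in _); rewrite ?normr1 ?normr0.
have I0 r : (\int[P]_t (\1_(f @^-1` [set r]) (W t) * X t)%:E = 0)%E.
  by rewrite -[RHS](X0 _ (mf r)) integral_indicM.
under eq_integral => t _.
  rewrite (fimfunEord f (W t)) mulr_suml -sumEFin.
  under eq_bigr do rewrite -mulrA EFinM.
  over.
rewrite /= integral_sum//=; last by move=> r; exact: integrableZl (iF _).
rewrite big1// => i _; rewrite integralZl//; last exact: iF.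
by rewrite I0 mule0.
Qed.

(** Simple functions increase to [phi], and dominated convergence with the bound [C * |X|] passes
    the vanishing integrals to the limit. *)
Lemma integral_bounded_eq0 X phi C : L1 X -> measurable_fun [set: S] phi ->
  (forall s, 0 <= phi s <= C) ->
  (forall B, measurable B -> \int[P]_(t in W @^-1` B) (X t)%:E = 0)%E ->
  (\int[P]_t (phi (W t) * X t)%:E = 0)%E.
Proof.
move=> iX mphi phiC X0; have mX := integrable_measurable iX.
have mphi' : measurable_fun [set: S] (EFin \o phi) by exact/measurable_EFinP.
pose f := nnsfun_approx measurableT mphi'.
have f_phi s : EFin \o f ^~ s @ \oo --> (phi s)%:E.
  apply: cvg_nnsfun_approx => // x _.
  by rewrite lee_fin; have /andP[] := phiC x.
have f_le n s : f n s <= phi s.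
  rewrite -lee_fin nnsfun_approxE; apply: (le_approx n) => // x _.
  by rewrite lee_fin; have /andP[] := phiC x.
have [//|||||_ _] := @dominated_convergence _ _ _ P setT measurableT
  (fun n t => (f n (W t) * X t)%:E) (fun t => (phi (W t) * X t)%:E)
  (fun t => (C * `|X t|)%:E).
- move=> n; apply/measurable_EFinP/measurable_funM => //.
  exact: (measurableT_comp _ mW).
- apply/measurable_EFinP/measurable_funM => //.
  exact: measurable_comp_real.
- apply: aeW => t _; under eq_fun do rewrite EFinM; rewrite EFinM.
  apply: cvgeM; [exact: mule_def_fin|exact: f_phi|exact: cvg_cst].
- have -> : (fun t => (C * `|X t|)%:E) = (fun t => C%:E * `|(EFin \o X) t|)%E.
    by apply/funext => t; rewrite EFinM.
  by apply: integrableZl => //; exact: integrable_abse.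
- apply: aeW => t n _; rewrite lee_fin normrM ler_wpM2r//.
  by rewrite ger0_norm// (le_trans (f_le _ _))//; have /andP[] := phiC (W t).
under eq_fun do rewrite (integral_nnsfun_eq0 _ iX X0).
by move=> /cvg_unique; apply => //; exact: cvg_cst.
Qed.

(** The residual [g(W) - X] integrates to zero over every event of [W], hence against every bounded
    nonnegative function of [W], and by differences against [phi * \1_B]. *)
Lemma is_regression_bounded_mul X g phi C : L1 X ->
  measurable_fun [set: S] phi -> (forall s, `|phi s| <= C) ->
  is_regression P W X g ->
  is_regression P W (fun t => phi (W t) * X t) (fun s => phi s * g s).
Proof.
move=> iX mphi phiC [mg ig gX].
have iM F : L1 F -> L1 (fun t => phi (W t) * F t).
  move=> iF; apply: (@integrable_bounded_mul _ _ _ _ _ _ C) => //.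
  - exact: measurable_comp_real.
  - exact: aeW.
split; [exact: measurable_funM|exact: iM|move=> B mB].
have mWB := measurable_preimage mB.
do 2![rewrite (@integral_indicM _ _ _ _ (W @^-1` B))//].
pose F t := g (W t) - X t.
have iF : L1 F by exact: integrable_realB.
have F0 D : measurable D -> (\int[P]_(t in W @^-1` D) (F t)%:E = 0)%E.
  move=> mD; have mWD := measurable_preimage mD.
  under eq_integral do rewrite EFinB.
  rewrite integralB_EFin//; [|exact: integrableS ig|exact: integrableS iX].
  rewrite gX// subee//; apply: integrable_fin_num => //.
  exact: integrableS iX.
have m1B : measurable_fun [set: S] (\1_B : S -> R) by exact: measurable_indic.
have C0 : 0 <= C by exact: le_trans (phiC point).
(* [phi * \1_B] is the difference of two functions with values in [0, 2C] *)
have h1 : (\int[P]_t ((phi (W t) + C) * \1_B (W t) * F t)%:E = 0)%E.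
  apply: (@integral_bounded_eq0 _ (fun s => (phi s + C) * \1_B s) (C + C)) => //.
    by apply: measurable_funM => //; exact: measurable_funD.
  move=> s; have /ler_normlP[p1 p2] := phiC s.
  by rewrite indicE; case: (_ \in _); rewrite ?mulr1 ?mulr0; lra.
have h2 : (\int[P]_t (C * \1_B (W t) * F t)%:E = 0)%E.
  apply: (@integral_bounded_eq0 _ (fun s => C * \1_B s) C) => //.
    by apply: measurable_funM.
  by move=> s; rewrite indicE; case: (_ \in _); rewrite ?mulr1 ?mulr0; lra.
have iBX (c : S -> R) : measurable_fun [set: S] c -> (forall s, `|c s| <= C + C) ->
    L1 (fun t => c (W t) * \1_B (W t) * F t).
  move=> mc cC; apply: (@integrable_bounded_mul _ _ _ _ _ _ (C + C)) => //.
    apply: measurable_funM; first exact: measurable_comp_real.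
    exact: measurable_comp_real.
  apply: aeW => t; rewrite normrM indicE; case: (_ \in _).
    by rewrite normr1 mulr1.
  by rewrite normr0 mulr0 addr_ge0.
have h : (\int[P]_t (\1_B (W t) * (phi (W t) * g (W t)) -
                     \1_B (W t) * (phi (W t) * X t))%:E = 0)%E.
  rewrite -(subee (x := 0%E))// -[in X in (X - _)%E]h1 -h2.
  rewrite -integralB_EFin//.
  - by apply: eq_integral => t _; congr EFin; rewrite /F; ring.
  - apply: (iBX (fun s => phi s + C)); first exact: measurable_funD.
    move=> s; apply: le_trans (ler_normD _ _) _.
    by rewrite (ger0_norm C0) lerD2r.
  - apply: (iBX (cst C)) => // s.
    by rewrite /= ger0_norm// lerDl.
have i1M G : L1 G -> L1 (fun t => \1_B (W t) * (phi (W t) * G t)).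
  move=> iG; apply: (@integrable_bounded_mul _ _ _ _ _ _ 1).
  - exact: measurable_comp_real.
  - by apply: aeW => t; rewrite indicE; case: (_ \in _); rewrite ?normr1 ?normr0.
  - exact: iM.
have := h; under eq_integral do rewrite EFinB.
rewrite integralB_EFin//; [|exact: (i1M _ ig)|exact: (i1M _ iX)].
move=> /eqP; rewrite sube_eq ?add0e => [/eqP//||].
- by apply: integrable_fin_num => //; exact: (i1M _ ig).
- exact: fin_num_adde_defr.
Qed.

(* Multiplying by 1 / (1 + |phi|) reduces the claim to a bounded factor. *)
Lemma is_regressionM X g phi : L1 X -> measurable_fun [set: S] phi ->
  L1 (fun t => phi (W t) * X t) -> is_regression P W X g ->
  is_regression P W (fun t => phi (W t) * X t) (fun s => phi s * g s).
Proof.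
move=> iX mphi iphiX rg; have rk := regression_exists iphiX.
have mg : measurable_fun [set: S] g by case: rg.
pose v s := damping (phi s).
have mv : measurable_fun [set: S] v.
  exact: measurableT_comp (@measurable_damping R) mphi.
have v1 s : `|v s| <= 1 by exact: normr_damping.
have vphi1 s : `|v s * phi s| <= 1 by exact: normr_dampingM.
have r1 := is_regression_bounded_mul iphiX mv v1 rk.
have r2 := is_regression_bounded_mul iX (measurable_funM mv mphi) vphi1 rg.
apply: is_regression_ext rk; first exact: measurable_funM.
have iv : L1 (fun t => v (W t) * (phi (W t) * X t)).
  apply: (@integrable_bounded_mul _ _ _ _ _ _ 1) => //.
  - exact: measurable_comp_real.
  - exact: aeW.
have /= := regression_unique iv r1.
have {}r2 : is_regression P W (fun t => v (W t) * (phi (W t) * X t))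
    (fun s => v s * (phi s * g s)).
  move: r2; under eq_fun do rewrite -mulrA.
  by under [X in is_regression _ _ _ X -> _]eq_fun do rewrite -mulrA.
move=> /(_ _ r2); apply: filterS => t /=.
by move/mulfI; apply; exact: damping_neq0.
Qed.

End regression_theory.

(** * Conditional independence *)

Section conditional_independence.
Context d (T : measurableType d) (R : realType) (P : probability T R).
Local Notation L1 F := (P.-integrable [set: T] (EFin \o F)).

(** An event of [k(W)] is an event of [W], so [g(W)] and [X] have the same integral over it. As an
    equivalence it serves both to coarsen the conditioning and to replace a variable by its finer
    regression. *)
Lemma is_regression_tower d1 (S1 : measurableType d1) d2 (S2 : measurableType d2)
    (W : T -> S1) (k : S1 -> S2) (X : T -> R) (g : S1 -> R) (h : S2 -> R) :
  measurable_fun [set: S1] k -> is_regression P W X g ->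
  is_regression P (fun t => k (W t)) (fun t => g (W t)) h <->
  is_regression P (fun t => k (W t)) X h.
Proof.
move=> mk [mg ig gX].
have gXk B : measurable B ->
    (\int[P]_(t in (fun t => k (W t)) @^-1` B) (g (W t))%:E =
     \int[P]_(t in (fun t => k (W t)) @^-1` B) (X t)%:E)%E.
  move=> mB; apply: (gX (k @^-1` B)).
  by rewrite -[X in measurable X]setTI; exact: mk.
by split=> -[mh ih hX]; split=> // B mB; rewrite hX// gXk.
Qed.

(** Rectangles are stable under intersection and generate the product sigma-algebra, while the sets
    where both integrals agree form a Dynkin class. Identities for regressions on a pair need thus
    be tested on rectangles only. *)
Lemma integral_preimage_setX d1 (S1 : measurableType d1)
    d2 (S2 : measurableType d2) (V : T -> S1 * S2) (F G : T -> R) :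
  measurable_fun [set: T] V -> L1 F -> L1 G ->
  (forall B1 B2, measurable B1 -> measurable B2 ->
    \int[P]_(t in V @^-1` (B1 `*` B2)) (F t)%:E =
    \int[P]_(t in V @^-1` (B1 `*` B2)) (G t)%:E)%E ->
  forall B, measurable B ->
    (\int[P]_(t in V @^-1` B) (F t)%:E = \int[P]_(t in V @^-1` B) (G t)%:E)%E.
Proof.
move=> mV iF iG FG B mB.
have mVB D : measurable D -> measurable (V @^-1` D).
  by move=> mD; rewrite -[X in measurable X]setTI; exact: mV.
pose Q D := (\int[P]_(t in V @^-1` D) (F t)%:E =
             \int[P]_(t in V @^-1` D) (G t)%:E)%E.
have iS K D : L1 K -> measurable D -> P.-integrable (V @^-1` D) (EFin \o K).
  by move=> iK mD; apply: integrableS iK => //; exact: mVB.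
have QT : Q setT.
  by rewrite /Q; have := FG setT setT measurableT measurableT; rewrite setXTT.
have QC D : measurable D -> Q D -> Q (~` D).
  move=> mD QD; have split K : L1 K -> (\int[P]_(t in V @^-1` ~` D) (K t)%:E =
      \int[P]_(t in V @^-1` setT) (K t)%:E - \int[P]_(t in V @^-1` D) (K t)%:E)%E.
    move=> iK; rewrite preimage_setT -(setUv (V @^-1` D)) integral_setU//.
    - rewrite [X in (X - _)%E]addeC addeK//.
      by apply: integrable_fin_num; [exact: mVB|exact: iS].
    - exact: mVB.
    - exact/measurableC/mVB.
    - by apply: measurable_funTS; exact: measurable_int iK.
    - by apply/disj_setPS; rewrite setICr.
  by rewrite /Q (split F)// (split G)// QD QT.
have QU (D : (set _)^nat) : (forall n, measurable (D n)) ->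
    trivIset [set: nat] D -> (forall n, Q (D n)) -> Q (\bigcup_k D k).
  move=> mD tD QD; have sum K : L1 K ->
      (\int[P]_(t in V @^-1` (\bigcup_k D k)) (K t)%:E =
       \sum_(k <oo) \int[P]_(t in V @^-1` D k) (K t)%:E)%E.
    move=> iK; rewrite preimage_bigcup integral_bigcup//.
    - apply/trivIsetP => i j _ _ ij; rewrite -preimage_setI.
      by move/trivIsetP : tD => /(_ i j I I ij) ->; rewrite preimage_set0.
    - by move=> k; exact: mVB.
    - by rewrite -preimage_bigcup; apply: iS => //; exact: bigcup_measurable.
  rewrite /Q (sum F)// (sum G)//; apply: eq_eseriesr => k _; exact: QD.
apply: (@dynkin_induction _ _ [set A `*` B | A in measurable & B in measurable] Q).
- exact: measurable_prod_measurableType.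
- move=> _ _ [A1 mA1 [B1 mB1 <-]] [A2 mA2 [B2 mB2 <-]].
  exists (A1 `&` A2); first exact: measurableI.
  by exists (B1 `&` B2); [exact: measurableI|rewrite setXI].
- exact: QT.
- by move=> _ [B1 mB1 [B2 mB2 <-]]; exact: FG.
- exact: QC.
- exact: QU.
- by rewrite -measurable_prod_measurableType.
Qed.

(** * Regression form of conditional independence *)

Context d0 (S : measurableType d0) d1 (S1 : measurableType d1)
  d2 (S2 : measurableType d2) (W : T -> S) (X1 : T -> S1) (X2 : T -> S2).
Hypothesis mW : measurable_fun [set: T] W.
Hypothesis mX1 : measurable_fun [set: T] X1.
Hypothesis mX2 : measurable_fun [set: T] X2.

Lemma cond_indep_sym : cond_indep P W X1 X2 -> cond_indep P W X2 X1.
Proof.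
move=> X12 B2 B1 mB2 mB1; apply: filterS (X12 _ _ mB1 mB2) => t.
by rewrite setIC mulrC.
Qed.

Hypothesis X12 : cond_indep P W X1 X2.

(** On the rectangle with sides [B1] and [C], pulling [q(W)] out of the regression of the indicator
    of [E1] gives the product of the two conditional probabilities, which independence turns into
    the conditional probability of the intersection. *)
Lemma cond_indep_indic (B2 : set S2) : measurable B2 ->
  is_regression P (fun t => (X1 t, W t)) (\1_(X2 @^-1` B2))
    (fun s => regression P W (\1_(X2 @^-1` B2)) s.2).
Proof.
move=> mB2; set q := regression P W _.
have mE2 : measurable (X2 @^-1` B2) := measurable_preimage mX2 mB2.
have iE2 := integrable_indicR P mE2.
have rq := regression_exists mW iE2.
have [mq iq _] := rq.
split=> //; first exact: measurableT_comp.
apply: integral_preimage_setX => //.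
  exact: measurable_fun_pair.
move=> B1 C mB1 mC.
pose E1 := X1 @^-1` B1.
have mE1 : measurable E1 := measurable_preimage mX1 mB1.
have mWC : measurable (W @^-1` C) := measurable_preimage mW mC.
have iE1 := integrable_indicR P mE1.
have rE1 := regression_exists mW iE1.
have iE12 := integrable_indicR P (measurableI _ _ mE1 mE2).
have rE12 := regression_exists mW iE12.
have iqE1 : L1 (fun t => q (W t) * \1_E1 t) by exact: integrable_mul_indic.
have r1 := is_regressionM mW iE1 mq iqE1 rE1.
have [_ _ /(_ _ mC) e1] := r1.
have r12 : is_regression P W (\1_(E1 `&` X2 @^-1` B2))
    (fun s => q s * regression P W \1_E1 s).
  apply: is_regression_ext rE12 => //.
    by apply: measurable_funM => //; case: rE1.
  apply: filterS (X12 mB1 mB2) => t.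
  by rewrite /cond_prob /cond_exp /= mulrC.
have [_ _ /(_ _ mC) e2] := r12.
have -> : (fun t => (X1 t, W t)) @^-1` (B1 `*` C) = W @^-1` C `&` E1.
  by rewrite setIC.
rewrite !integral_mkcondr.
transitivity (\int[P]_(t in W @^-1` C) (q (W t) * \1_E1 t)%:E)%E.
  apply: eq_integral => t _; rewrite patchE indicE.
  by case: (t \in E1); rewrite ?mulr1 ?mulr0.
rewrite -e1 e2; apply: eq_integral => t _; rewrite patchE !indicE in_setI.
by case: (t \in E1).
Qed.

(** With [q] the conditional probability of [E2] given [W], three identities over events of [W]
    suffice: [f * \1_E2] integrates like [f * q] by conditioning on [(X1, W)], [g * \1_E2] like
    [g * q] by conditioning on [W], and [q * f] like [q * g] because [g] is the regression of
    [f]. *)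
Lemma cond_indep_regression (f : S1 * S -> R) (g : S -> R) :
  measurable_fun [set: S1 * S] f -> L1 (fun t => f (X1 t, W t)) ->
  is_regression P W (fun t => f (X1 t, W t)) g ->
  is_regression P (fun t => (X2 t, W t)) (fun t => f (X1 t, W t))
    (fun s => g s.2).
Proof.
move=> mf if1 rg; have [mg ig _] := rg.
split=> //; first exact: measurableT_comp.
apply: integral_preimage_setX => //.
  exact: measurable_fun_pair.
move=> B2 C mB2 mC; pose E2 := X2 @^-1` B2.
have mE2 : measurable E2 := measurable_preimage mX2 mB2.
have iE2 := integrable_indicR P mE2.
have r2 := cond_indep_indic mB2; set q := regression P W _ in r2.
have rq : is_regression P W \1_E2 q := regression_exists mW iE2.
have mX1W : measurable_fun [set: T] (fun t => (X1 t, W t)).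
  exact: measurable_fun_pair.
have i1M F : L1 F -> L1 (fun t => F t * \1_E2 t).
  by move=> iF; exact: integrable_mul_indic.
have ifE := i1M _ if1; have igE := i1M _ ig.
have q1 : {ae P, forall t, `|q (W t)| <= 1}.
  apply: (regression_bounded mW rq); first exact: measurable_indic.
  by apply: aeW => t; rewrite indicE; case: (_ \in _); rewrite ?normr1 ?normr0.
have iqf : L1 (fun t => q (W t) * f (X1 t, W t)).
  apply: (@integrable_bounded_mul _ _ _ _ _ _ 1) => //.
  by apply: (measurableT_comp _ mW); case: rq.
have rf := is_regressionM mX1W iE2 mf ifE r2.
have rg2 := is_regressionM mW iE2 mg igE rq.
have rqg := is_regressionM mW if1 (let: And3 mq _ _ := rq in mq) iqf rg.
have [_ _ /(_ _ (measurableX measurableT mC))] := rf.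
have [_ _ /(_ _ mC)] := rg2.
have [_ _ /(_ _ mC)] := rqg.
have -> : (fun t => (X1 t, W t)) @^-1` (setT `*` C) = W @^-1` C.
  by apply/seteqP; split=> t /= => [[]|].
have -> : (fun t => (X2 t, W t)) @^-1` (B2 `*` C) = W @^-1` C `&` E2.
  by rewrite setIC.
move=> e1 e2 e3; rewrite !integral_mkcondr.
transitivity (\int[P]_(t in W @^-1` C) (g (W t) * \1_E2 t)%:E)%E.
  apply: eq_integral => t _; rewrite patchE indicE.
  by case: (t \in E2); rewrite ?mulr1 ?mulr0.
transitivity (\int[P]_(t in W @^-1` C) (f (X1 t, W t) * \1_E2 t)%:E)%E; last first.
  apply: eq_integral => t _; rewrite patchE indicE.
  by case: (t \in E2); rewrite ?mulr1 ?mulr0.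
rewrite -e2 -e3 /=.
under eq_integral do rewrite mulrC.
rewrite e1.
by under eq_integral do rewrite mulrC.
Qed.

End conditional_independence.

(** * Multiplicative instrumental variables *)

Section regression_positivity.
Context d (T : measurableType d) (R : realType) (P : probability T R).
Context d' (S : measurableType d') (W : T -> S).
Hypothesis mW : measurable_fun [set: T] W.
Local Notation L1 F := (P.-integrable [set: T] (EFin \o F)).

Lemma measurable_zero_set (g : S -> R) :
  measurable_fun [set: S] g -> measurable [set s | g s = 0].
Proof.
move=> mg; have -> : [set s | g s = 0] = [set: S] `&` g @^-1` [set 0].
  by rewrite setTI.
exact: mg.
Qed.

Lemma ge0_integral0_ae (F : T -> R) : L1 F -> {ae P, forall t, 0 <= F t} ->
  (\int[P]_t (F t)%:E = 0)%E -> {ae P, forall t, F t = 0}.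
Proof.
move=> iF F0 IF; have mF := integrable_measurable iF.
have aF : {ae P, forall t, F t = `|F t|}.
  by apply: filterS F0 => t F0; rewrite ger0_norm.
have mE : measurable_fun [set: T] (EFin \o F) by exact/measurable_EFinP.
have : (\int[P]_t `|(EFin \o F) t| = 0)%E.
  rewrite -IF; symmetry; apply: eq_integral_ae => //.
  exact: measurableT_comp.
move/(ae_eq_integral_abs _ measurableT mE); apply: filterS => t /(_ I).
by case.
Qed.

(** On the event [g(W) = 0] the nonnegative [X] integrates to zero, so [X] and with it [Y] vanish
    there. Then [h(W)] vanishes there as well, which forces the event to be null. This keeps the
    denominators below away from zero. *)
Lemma regression_neq0 (X Y : T -> R) (g h : S -> R) :
  L1 X -> L1 Y -> is_regression P W X g -> is_regression P W Y h ->
  {ae P, forall t, 0 <= X t} -> {ae P, forall t, X t = 0 -> Y t = 0} ->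
  {ae P, forall t, h (W t) != 0} -> {ae P, forall t, g (W t) != 0}.
Proof.
move=> iX iY rg rh X0 XY h0; have [mg _ _] := rg; have [mh _ _] := rh.
pose B := [set s | g s = 0].
have mB : measurable B by exact: measurable_zero_set.
have m1 : measurable_fun [set: S] (\1_B : S -> R) by exact: measurable_indic.
have B1 s : `|\1_B s : R| <= 1.
  by rewrite indicE; case: (_ \in _); rewrite ?normr1 ?normr0.
have iM F : L1 F -> L1 (fun t => \1_B (W t) * F t).
  move=> iF; apply: (@integrable_bounded_mul _ _ _ _ _ _ 1) => //.
    exact: measurable_comp_real.
  by apply: aeW => t; exact: B1.
have : {ae P, forall t, \1_B (W t) * X t = 0}.
  apply: ge0_integral0_ae.
  - exact: iM.
  - by apply: filterS X0 => t X0; rewrite mulr_ge0.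
  - have [_ _ /(_ _ measurableT)] := is_regression_bounded_mul mW iX m1 B1 rg.
    rewrite preimage_setT => <-; apply: integral0_eq => t _.
    rewrite indicE; have [|] := boolP (W t \in B); last by rewrite mul0r.
    by rewrite inE => ->; rewrite mulr0.
move=> BX.
have BY : {ae P, forall t, 0 = \1_B (W t) * Y t}.
  apply: filterS2 BX XY => t BX XY; have [|B0] := eqVneq (\1_B (W t) : R) 0.
    by move=> ->; rewrite mul0r.
  by rewrite XY ?mulr0//; move/eqP: BX; rewrite mulf_eq0 (negbTE B0) => /eqP.
have r0 : is_regression P W (cst 0 : T -> R) (cst 0).
  split=> //; first exact: finite_measure_integrable_cst.
have iBY := iM _ iY.
have rB0 : is_regression P W (fun t => \1_B (W t) * Y t) (cst 0).
  apply: is_regression_ae BY r0 => //; first exact: finite_measure_integrable_cst.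
  exact: (integrable_measurable iBY).
have rBh := is_regression_bounded_mul mW iY m1 B1 rh.
have := regression_unique mW iBY rBh rB0.
apply: filterS2 h0 => t h0 /= /eqP; rewrite mulf_eq0 (negbTE h0) orbF.
apply: contraTneq => g0; rewrite indicE mem_set ?oner_eq0//.
Qed.

End regression_positivity.

(** * Consequences of latent ignorability, IV independence and the multiplicative form *)

Section multiplicative_iv_theory.
Context d (T : measurableType d) (R : realType) (P : probability T R).
Context dA (SA : measurableType dA) dZ (SZ : measurableType dZ).
Context dL (SL : measurableType dL) dU (SU : measurableType dU).
Context (A : T -> SA) (Z : T -> SZ) (L : T -> SL) (U : T -> SU).
Context (a : SA) (X : T -> R).
Hypothesis mA : measurable_fun [set: T] A.
Hypothesis mZ : measurable_fun [set: T] Z.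
Hypothesis mL : measurable_fun [set: T] L.
Hypothesis mU : measurable_fun [set: T] U.
Hypothesis ma : measurable [set a].
Local Notation L1 F := (P.-integrable [set: T] (EFin \o F)).
Hypothesis iX : L1 X.
Hypothesis latent : cond_indep P (fun t => (U t, L t)) X (fun t => (A t, Z t)).
Hypothesis ivi : cond_indep P L Z U.

Let mX : measurable_fun [set: T] X := integrable_measurable iX.
(** Conditioning descends from [W4] to [W3], then to [ZL] or [UL], and finally to [L]. The
    projections [k43], [k3Z] and [k3U] present each coarser variable as a function of the finer one,
    as the tower property requires. *)
Let UL t := (U t, L t).
Let ZL t := (Z t, L t).
Let W3 t := (Z t, U t, L t).
Let W4 t := ((A t, Z t), (U t, L t)).
Let mUL : measurable_fun [set: T] UL. Proof. exact: measurable_fun_pair. Qed.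
Let mZL : measurable_fun [set: T] ZL. Proof. exact: measurable_fun_pair. Qed.
Let mAZ : measurable_fun [set: T] (fun t => (A t, Z t)).
Proof. exact: measurable_fun_pair. Qed.
Let mW3 : measurable_fun [set: T] W3.
Proof. by do 2!apply: measurable_fun_pair => //. Qed.
Let mW4 : measurable_fun [set: T] W4. Proof. exact: measurable_fun_pair. Qed.

Let k43 (s : SA * SZ * (SU * SL)) := (s.1.2, s.2.1, s.2.2).
Let mk43 : measurable_fun [set: SA * SZ * (SU * SL)] k43.
Proof.
apply: measurable_fun_pair; last exact: measurableT_comp.
by apply: measurable_fun_pair; exact: measurableT_comp.
Qed.

Let k3Z (s : SZ * SU * SL) := (s.1.1, s.2).
Let mk3Z : measurable_fun [set: SZ * SU * SL] k3Z.
Proof. by apply: measurable_fun_pair => //; exact: measurableT_comp. Qed.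

Let k3U (s : SZ * SU * SL) := (s.1.2, s.2).
Let mk3U : measurable_fun [set: SZ * SU * SL] k3U.
Proof. by apply: measurable_fun_pair => //; exact: measurableT_comp. Qed.

Let h := regression P UL X.
Let rh : is_regression P UL X h. Proof. exact: regression_exists. Qed.
Let mh : measurable_fun [set: SU * SL] h. Proof. by case: rh. Qed.
Let ih : L1 (fun t => h (UL t)). Proof. by case: rh. Qed.

(** Latent ignorability in regression form, with [f] the first projection. *)
Let rX4 : is_regression P W4 X (fun s => h s.2).
Proof.
exact: (@cond_indep_regression _ _ _ _ _ _ _ _ _ _ _ X _ mUL mX mAZ latent fst).
Qed.

(** IV independence in regression form, with the roles of [Z] and [U] exchanged; it averages out [U]
    once [(Z, L)] is fixed. *)
Lemma regression_instrument_latent (f : SU * SL -> R) (g : SL -> R) :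
  measurable_fun [set: SU * SL] f -> L1 (fun t => f (UL t)) ->
  is_regression P L (fun t => f (UL t)) g ->
  is_regression P ZL (fun t => f (UL t)) (fun s => g s.2).
Proof.
by move=> mf jf rg; apply: (cond_indep_regression mL mU mZ (cond_indep_sym ivi) mf).
Qed.

Lemma regression_latent_instrument (f : SZ * SL -> R) (g : SL -> R) :
  measurable_fun [set: SZ * SL] f -> L1 (fun t => f (ZL t)) ->
  is_regression P L (fun t => f (ZL t)) g ->
  is_regression P UL (fun t => f (ZL t)) (fun s => g s.2).
Proof.
by move=> mf jf rg; apply: (cond_indep_regression mL mZ mU ivi mf).
Qed.

(** By latent ignorability [X] may be replaced by [h(U, L)] before conditioning on [(Z, L)], and IV
    independence then removes [Z]. *)
Lemma regression_outcome (m : SL -> R) : is_regression P L X m ->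
  is_regression P ZL X (fun s => m s.2).
Proof.
move=> rm.
have rZ : is_regression P ZL (fun t => h (UL t)) (fun s => m s.2).
  apply: regression_instrument_latent => //.
  exact/(is_regression_tower m (@measurable_snd _ _ SU SL) rh).
have r4 : is_regression P ZL (fun t => h (UL t)) (fun s => m s.2) ->
    is_regression P ZL X (fun s => m s.2).
  have mk : measurable_fun [set: SA * SZ * (SU * SL)] (fun s => (s.1.2, s.2.2)).
    by apply: measurable_fun_pair; exact: measurableT_comp.
  by move=> r; apply/(is_regression_tower _ mk rX4).
exact: r4.
Qed.

Let A0 : T -> R := \1_[set t | A t <> a].
Let E0 : measurable [set t | A t <> a].
Proof. exact: (measurable_preimage mA (measurableC ma)). Qed.
Let iA0 : L1 A0. Proof. exact: integrable_indicR. Qed.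
Let mA0 : measurable_fun [set: T] A0. Proof. exact: measurable_indic. Qed.
Let A0_ge0 t : 0 <= A0 t. Proof. by rewrite /A0 indicE. Qed.
Let A0_le1 t : `|A0 t| <= 1.
Proof. by rewrite /A0 indicE; case: (_ \in _); rewrite ?normr1 ?normr0. Qed.
Let iA0X : L1 (fun t => A0 t * X t).
Proof.
by apply: (@integrable_bounded_mul _ _ _ _ _ _ 1) => //; apply: aeW => t.
Qed.

Let e := regression P W3 A0.
Let re : is_regression P W3 A0 e. Proof. exact: regression_exists. Qed.
Let ie : L1 (fun t => e (W3 t)). Proof. by case: re. Qed.
Let e_ge0 : {ae P, forall t, 0 <= e (W3 t)}.
Proof.
have r0 : is_regression P W3 (cst 0 : T -> R) (cst 0).
  by split=> //; exact: finite_measure_integrable_cst.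
apply: (regression_le mW3 r0 re) => //; first exact: finite_measure_integrable_cst.
exact: aeW.
Qed.

(** Given [(A, Z, U, L)] the indicator [A0] is known and [X] averages to [h(U, L)]; conditioning
    further on [(Z, U, L)] leaves [h] fixed and turns [A0] into [e]. *)
Let regression_untreated_outcome_fine :
  is_regression P W3 (fun t => A0 t * X t) (fun s => h (k3U s) * e s).
Proof.
pose phi (s : SA * SZ * (SU * SL)) : R := \1_[set s | s.1.1 <> a] s.
have mphi : measurable_fun [set: SA * SZ * (SU * SL)] phi.
  apply: measurable_indic.
  have mf : measurable_fun [set: SA * SZ * (SU * SL)] (fun s => s.1.1).
    exact: measurableT_comp.
  exact: (measurable_preimage mf (measurableC ma)).
have phi1 s : `|phi s| <= 1.
  by rewrite /phi indicE; case: (_ \in _); rewrite ?normr1 ?normr0.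
have := is_regression_bounded_mul mW4 iX mphi phi1 rX4.
have phiE t : phi (W4 t) = A0 t by [].
move=> r4; have i4 : L1 (fun t => A0 t * h (UL t)) by case: r4.
have ihA0 : L1 (fun t => h (k3U (W3 t)) * A0 t).
  by move: i4; under eq_fun do rewrite mulrC.
apply/(is_regression_tower _ mk43 r4).
have := is_regressionM mW3 iA0 (measurableT_comp mh mk3U) ihA0 re.
by under [fun t => _ (W3 t) * _]eq_fun do rewrite mulrC.
Qed.

Hypothesis mult : multiplicative_iv P A Z L U a.
Let q := regression P L A0.
Hypothesis q_neq0 : {ae P, forall t, q (L t) != 0}.
Let rq : is_regression P L A0 q. Proof. exact: regression_exists. Qed.

(* With u = 1 / (1 + |b|), E[u A0 | Z, L] = c E[u b | L] is bounded and equals c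
   up to a function of L; once it replaces c, conditioning on (U, L) shows that
   b is Pr(A <> a | U, L) up to a function of L. *)
Lemma multiplicative_iv_bounded : exists c2 : SZ * SL -> R,
  measurable_fun [set: SZ * SL] c2 /\
  {ae P, forall t, e (W3 t) = regression P UL A0 (UL t) * c2 (ZL t)}.
Proof.
have [b [c [mb mc ebc]]] := mult.
(* As a conditional probability, [e] is nonnegative, so the factors may be replaced by their
   absolute values. *)
have {}ebc : {ae P, forall t, e (W3 t) = `|b (UL t)| * `|c (ZL t)|}.
  apply: filterS2 ebc e_ge0 => t ebc e0.
  by rewrite -normrM -[RHS](congr1 Num.norm ebc) ger0_norm.
pose u s := damping (b s).
have mu : measurable_fun [set: SU * SL] u.
  exact: measurableT_comp (@measurable_damping R) mb.
have mnb : measurable_fun [set: SU * SL] (fun s => `|b s|).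
  exact: measurableT_comp.
have mnc : measurable_fun [set: SZ * SL] (fun s => `|c s|).
  exact: measurableT_comp.
have u0 s : 0 < u s := damping_gt0 _.
pose ub s := u s * `|b s|.
have mub : measurable_fun [set: SU * SL] ub by exact: measurable_funM.
have ub1 s : `|ub s| <= 1 by rewrite /ub normrM normr_id -normrM; exact: normr_dampingM.
have iub : L1 (fun t => ub (UL t)).
  by apply: (@integrable_bounded _ _ _ _ _ 1); [exact: measurable_comp_real|exact: aeW].
pose F1 t := u (UL t) * A0 t.
have iF1 : L1 F1.
  apply: (@integrable_bounded_mul _ _ _ _ _ _ 1) => //; first exact: measurable_comp_real.
  by apply: aeW => t; exact: normr_damping.
pose alpha := regression P ZL F1.
have ralpha : is_regression P ZL F1 alpha by exact: regression_exists.
have [malpha ialpha _] := ralpha.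
pose gamma := regression P L (fun t => ub (UL t)).
have rgamma : is_regression P L (fun t => ub (UL t)) gamma by exact: regression_exists.
have [mgamma _ _] := rgamma.
have rF1 : is_regression P W3 F1 (fun s => u (k3U s) * e s).
  exact: (is_regressionM mW3 iA0 (measurableT_comp mu mk3U) iF1 re).
have iue : L1 (fun t => u (UL t) * e (W3 t)) by case: rF1.
have eue : {ae P, forall t, u (UL t) * e (W3 t) = `|c (ZL t)| * ub (UL t)}.
  by apply: filterS ebc => t ->; rewrite /ub; ring.
have mcub : measurable_fun [set: T] (fun t => `|c (ZL t)| * ub (UL t)).
  exact: measurable_funM (measurable_comp_real mZL mnc) (measurable_comp_real mUL mub).
have icub : L1 (fun t => `|c (ZL t)| * ub (UL t)).
  exact: (integrable_real_ae iue).
have alphaE : {ae P, forall t, alpha (ZL t) = `|c (ZL t)| * gamma (L t)}.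
  have r1 : is_regression P ZL (fun t => `|c (ZL t)| * ub (UL t)) alpha.
    apply: (is_regression_ae mZL iue mcub eue).
    exact/(is_regression_tower _ mk3Z rF1).
  have r2 := regression_instrument_latent mub iub rgamma.
  exact: (regression_unique mZL icub r1 (is_regressionM mZL iub mnc icub r2)).
pose kappa := regression P L F1.
have rkappa : is_regression P L F1 kappa by exact: regression_exists.
have [mkappa _ _] := rkappa.
have rkappa' : is_regression P L (fun t => alpha (ZL t)) kappa.
  exact/(is_regression_tower _ (@measurable_snd _ _ SZ SL) ralpha).
(* Since [u] is positive, [u * A0] vanishes only where [A0] does, so [q] nonzero carries over. *)
have kappa0 : {ae P, forall t, kappa (L t) != 0}.
  apply: (regression_neq0 mL iF1 iA0 rkappa rq) q_neq0.
  - by apply: aeW => t; rewrite mulr_ge0// ltW.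
  - by apply: aeW => t /eqP; rewrite mulf_eq0 gt_eqF//= => /eqP.
(* Where [u * |b|] vanishes so does [e], whose regression on [L] is again [q]. *)
have gamma0 : {ae P, forall t, gamma (L t) != 0}.
  have rqe : is_regression P L (fun t => e (W3 t)) q.
    exact/(is_regression_tower _ (@measurable_snd _ _ (SZ * SU)%type SL) re).
  apply: (regression_neq0 mL iub ie rgamma rqe) q_neq0.
  - by apply: aeW => t; rewrite mulr_ge0// ltW.
  - apply: filterS ebc => t -> /eqP.
    by rewrite mulf_eq0 gt_eqF//= => /eqP ->; rewrite mul0r.
(* As [alpha] is [|c| * gamma], dividing [|b|] by [gamma] lets the integrable [alpha] take the place
   of [|c|]. *)
pose b2 s := `|b s| / gamma s.2.
have mb2 : measurable_fun [set: SU * SL] b2.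
  apply: measurable_funM => //; apply: (measurableT_comp (@measurable_invr R)).
  exact: measurableT_comp.
have eb2 : {ae P, forall t, e (W3 t) = b2 (UL t) * alpha (ZL t)}.
  apply: filterS3 ebc alphaE gamma0 => t -> -> g0.
  by rewrite /b2 /=; field.
have mb2a : measurable_fun [set: T] (fun t => b2 (UL t) * alpha (ZL t)).
  exact: measurable_funM (measurable_comp_real mUL mb2) (measurable_comp_real mZL malpha).
have ib2a := integrable_real_ae ie mb2a eb2.
have b''E : {ae P, forall t, regression P UL A0 (UL t) = b2 (UL t) * kappa (L t)}.
  have rb : is_regression P UL A0 (regression P UL A0) by exact: regression_exists.
  have r1 : is_regression P UL (fun t => b2 (UL t) * alpha (ZL t))
      (regression P UL A0).
    apply: (is_regression_ae mUL ie mb2a eb2).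
    exact/(is_regression_tower _ mk3U re).
  have r2 := regression_latent_instrument malpha ialpha rkappa'.
  exact: (regression_unique mUL ib2a r1 (is_regressionM mUL ialpha mb2 ib2a r2)).
(* The conditional probability given [(U, L)] is [b2 * kappa], so the factor [kappa] it absorbs is
   divided out of [alpha]. *)
exists (fun s => alpha s / kappa s.2); split.
  apply: measurable_funM => //; apply: (measurableT_comp (@measurable_invr R)).
  exact: measurableT_comp.
apply: filterS3 eb2 b''E kappa0 => t -> -> k0 /=.
by field.
Qed.

(** With the bounded factor [b2] in place of [b], both regressions on [(Z, L)] are [c2] times a
    function of [L]: the mean of [b2 * h] given [L], called [theta], and the mean of [b2] given [L],
    which is [q]. Their quotient is [rho]. *)
Lemma regression_untreated_outcome : exists rho : SL -> R,
  measurable_fun [set: SL] rho /\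
  {ae P, forall t, regression P ZL (fun t => A0 t * X t) (ZL t) =
                   rho (L t) * regression P ZL A0 (ZL t)}.
Proof.
have [c2 [mc2 ec2]] := multiplicative_iv_bounded.
set b2 := regression P UL A0 in ec2.
have rb2 : is_regression P UL A0 b2 by exact: regression_exists.
have [mb2 ib2 _] := rb2.
have b2_le1 : {ae P, forall t, `|b2 (UL t)| <= 1}.
  by apply: (regression_bounded mUL rb2) => //; exact: aeW.
set p0 := regression P ZL A0; set k := regression P ZL (fun t => A0 t * X t).
have rp0 : is_regression P ZL A0 p0 by exact: regression_exists.
have rk : is_regression P ZL (fun t => A0 t * X t) k by exact: regression_exists.
have mcb : measurable_fun [set: T] (fun t => c2 (ZL t) * b2 (UL t)).
  exact: measurable_funM (measurable_comp_real mZL mc2) (measurable_comp_real mUL mb2).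
have ecb : {ae P, forall t, e (W3 t) = c2 (ZL t) * b2 (UL t)}.
  by apply: filterS ec2 => t ->; rewrite mulrC.
have icb := integrable_real_ae ie mcb ecb.
have p0E : {ae P, forall t, p0 (ZL t) = c2 (ZL t) * q (L t)}.
  have r1 : is_regression P ZL (fun t => c2 (ZL t) * b2 (UL t)) p0.
    apply: (is_regression_ae mZL ie mcb ecb).
    exact/(is_regression_tower _ mk3Z re).
  have rb2q : is_regression P L (fun t => b2 (UL t)) q.
    exact/(is_regression_tower _ (@measurable_snd _ _ SU SL) rb2).
  have r2 := regression_instrument_latent mb2 ib2 rb2q.
  exact: (regression_unique mZL icb r1 (is_regressionM mZL ib2 mc2 icb r2)).
pose bh s := b2 s * h s.
have mbh : measurable_fun [set: SU * SL] bh by exact: measurable_funM.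
have ibh : L1 (fun t => bh (UL t)).
  apply: (@integrable_bounded_mul _ _ _ _ _ _ 1 _ b2_le1 ih).
  exact: measurable_comp_real.
pose theta := regression P L (fun t => bh (UL t)).
have rtheta : is_regression P L (fun t => bh (UL t)) theta by exact: regression_exists.
have [mtheta _ _] := rtheta.
have mcbh : measurable_fun [set: T] (fun t => c2 (ZL t) * bh (UL t)).
  exact: measurable_funM (measurable_comp_real mZL mc2) (measurable_comp_real mUL mbh).
have [mhe ihe _] := regression_untreated_outcome_fine.
have ecbh : {ae P, forall t, h (k3U (W3 t)) * e (W3 t) = c2 (ZL t) * bh (UL t)}.
  by apply: filterS ec2 => t ->; rewrite /bh /=; ring.
have icbh := integrable_real_ae ihe mcbh ecbh.
have kE : {ae P, forall t, k (ZL t) = c2 (ZL t) * theta (L t)}.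
  have r1 : is_regression P ZL (fun t => c2 (ZL t) * bh (UL t)) k.
    apply: (is_regression_ae mZL ihe mcbh ecbh).
    exact/(is_regression_tower _ mk3Z regression_untreated_outcome_fine).
  have r2 := regression_instrument_latent mbh ibh rtheta.
  exact: (regression_unique mZL icbh r1 (is_regressionM mZL ibh mc2 icbh r2)).
exists (fun s => theta s / q s); split.
  apply: measurable_funM => //; apply: (measurableT_comp (@measurable_invr R)).
  by case: rq.
apply: filterS3 kE p0E q_neq0 => t -> -> q0.
by field.
Qed.

End multiplicative_iv_theory.

(** * Weighting functions *)

Section weighting.
Context d (T : measurableType d) (R : realType) (P : probability T R).
Context dA (SA : measurableType dA) dZ (SZ : measurableType dZ).
Context dL (SL : measurableType dL).
Context (A : T -> SA) (Z : T -> SZ) (L : T -> SL) (a : SA).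
Hypothesis mA : measurable_fun [set: T] A.
Hypothesis mZ : measurable_fun [set: T] Z.
Hypothesis mL : measurable_fun [set: T] L.
Hypothesis ma : measurable [set a].
Local Notation L1 F := (P.-integrable [set: T] (EFin \o F)).
Context (p : SZ * SL -> R) (C : R).
Hypothesis mp : measurable_fun [set: SZ * SL] p.
Hypothesis pC : forall t, `|p (Z t, L t)| <= C.

Let ZL t := (Z t, L t).
Let mZL : measurable_fun [set: T] ZL. Proof. exact: measurable_fun_pair. Qed.
Let pZL t := p (ZL t).
Let mpZL : measurable_fun [set: T] pZL. Proof. exact: measurable_comp_real. Qed.
Let ipZL : L1 pZL.
Proof. by apply: (@integrable_bounded _ _ _ _ _ C) => //; exact: aeW. Qed.
Let pbar := regression P L pZL.
Let rpbar : is_regression P L pZL pbar. Proof. exact: regression_exists. Qed.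
Let mpbar : measurable_fun [set: SL] pbar. Proof. by case: rpbar. Qed.
Let ipbar : L1 (fun t => pbar (L t)). Proof. by case: rpbar. Qed.

(** The weight minus its mean given [L]. It is orthogonal to functions of [L], so its product with
    [V] has the conditional covariance of [V] and the weight as regression on [L]. *)
Definition centered_weight (s : SZ * SL) : R := p s - pbar s.2.
Local Notation D := centered_weight.

Lemma measurable_centered_weight : measurable_fun [set: SZ * SL] D.
Proof. by apply: measurable_funB => //; exact: measurableT_comp. Qed.
Let mD := measurable_centered_weight.

Lemma centered_weight_bounded : {ae P, forall t, `|D (ZL t)| <= C + C}.
Proof.
have : {ae P, forall t, `|pbar (L t)| <= C}.
  by apply: (regression_bounded mL rpbar) => //; exact: aeW.
apply: filterS => t pb; rewrite (le_trans (ler_normB _ _))// lerD//.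
exact: pC.
Qed.

Lemma integrable_centered_weightM (V : T -> R) :
  L1 V -> L1 (fun t => D (ZL t) * V t).
Proof.
move=> iV; apply: integrable_bounded_mul centered_weight_bounded iV.
exact: measurable_comp_real.
Qed.

Let iD : L1 (fun t => D (ZL t)). Proof. exact: integrable_realB. Qed.

Lemma regression_centered_weight : is_regression P L (fun t => D (ZL t)) (cst 0).
Proof.
have rb : is_regression P L (fun t => pbar (L t)) pbar by [].
have := is_regressionB mL ipZL ipbar rpbar rb.
by apply: is_regression_ext => //; apply: aeW => t /=; rewrite subrr.
Qed.

Lemma regression_centered_weightM (g : SL -> R) :
  measurable_fun [set: SL] g -> L1 (fun t => g (L t)) ->
  is_regression P L (fun t => D (ZL t) * g (L t)) (cst 0).
Proof.
move=> mg ig; have igD : L1 (fun t => g (L t) * D (ZL t)).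
  have := integrable_centered_weightM ig.
  by under eq_fun do rewrite mulrC.
have := is_regressionM mL iD mg igD regression_centered_weight.
under eq_fun do rewrite mulrC.
by apply: is_regression_ext => //; apply: aeW => t /=; rewrite mulr0.
Qed.

(** The function on the right is the conditional covariance. Centering [V] as well changes nothing,
    because the centered weight times a function of [L] has regression 0. *)
Lemma is_regression_cond_cov (V : T -> R) : L1 V ->
  is_regression P L (fun t => D (ZL t) * V t) (regression P L (fun t =>
    (V t - cond_exp P L V t) * (pZL t - cond_exp P L pZL t))).
Proof.
move=> iV; set g := regression P L _.
have rV : is_regression P L V (regression P L V) by exact: regression_exists.
have [mgV igV _] := rV.
have iVD := integrable_centered_weightM (integrable_realB iV igV).
have VDE : (fun t => (V t - cond_exp P L V t) * (pZL t - cond_exp P L pZL t)) =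
    (fun t => D (ZL t) * (V t - regression P L V (L t))).
  by apply/funext => t; rewrite mulrC.
have rg : is_regression P L
    (fun t => D (ZL t) * (V t - regression P L V (L t))) g.
  by rewrite /g VDE; exact: regression_exists.
have := is_regressionD mL iVD (integrable_centered_weightM igV) rg
  (regression_centered_weightM mgV igV).
under eq_fun do rewrite -mulrDr subrK.
apply: (is_regression_ext mL); first by case: rg.
by apply: aeW => t /=; rewrite addr0.
Qed.

Let A1 := treated R A a.
Let A0 : T -> R := \1_[set t | A t <> a].
Let mE : measurable [set t | A t = a]. Proof. exact: (measurable_preimage mA ma). Qed.
Let E0 : measurable [set t | A t <> a]. Proof. exact: measurableC. Qed.
Let iA1 : L1 A1. Proof. exact: integrable_indicR. Qed.
Let iA0 : L1 A0. Proof. exact: integrable_indicR. Qed.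

Lemma indic_neqE t : A0 t = 1 - A1 t.
Proof.
rewrite /A0 /A1 /treated !indicE.
have [Aa|Aa] := pselect (A t = a).
  by rewrite memNset ?mem_set// ?subrr//; apply.
by rewrite mem_set ?memNset// subr0.
Qed.

Hypothesis cov_neq0 : {ae P, forall t, cond_cov P L A1 pZL t != 0}.
Let cov := regression P L (fun t =>
    (A1 t - cond_exp P L A1 t) * (pZL t - cond_exp P L pZL t)).
Let rcov : is_regression P L (fun t => D (ZL t) * A1 t) cov.
Proof. exact: is_regression_cond_cov. Qed.
Let iDA1 := integrable_centered_weightM iA1.
Let iDA0 := integrable_centered_weightM iA0.

Let rcov0 : is_regression P L (fun t => D (ZL t) * A0 t) (fun s => 0 - cov s).
Proof.
have := is_regressionB mL iD iDA1 regression_centered_weight rcov.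
by under eq_fun do rewrite -{1}(mulr1 (D _)) -mulrBr -indic_neqE.
Qed.

(** Positivity of the probability of [A <> a] given [L]: where it vanished, [A0] and hence its
    covariance with the weight would vanish too. *)
Lemma untreated_neq0 : {ae P, forall t, regression P L A0 (L t) != 0}.
Proof.
have rA0 := regression_exists mL iA0.
apply: (regression_neq0 mL iA0 iDA0 rA0 rcov0).
- by apply: aeW => t; rewrite /A0 indicE.
- by apply: aeW => t ->; rewrite mulr0.
- by apply: filterS cov_neq0 => t; rewrite sub0r oppr_eq0.
Qed.

(** The hypothesis describes the difference of two solutions, a function of [(A1, L)] written as
    affine in [A1]. The centered weight annihilates the part in [d0] alone and leaves
    [(d1 - d0) * cov]. *)
Lemma regression_treated_unique (d0 d1 : SL -> R) (z : SZ * SL -> R) :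
  measurable_fun [set: SL] d0 -> measurable_fun [set: SL] d1 ->
  L1 (fun t => d0 (L t) + (d1 (L t) - d0 (L t)) * A1 t) ->
  is_regression P ZL (fun t => d0 (L t) + (d1 (L t) - d0 (L t)) * A1 t) z ->
  {ae P, forall t, z (ZL t) = 0} ->
  {ae P, forall t, d0 (L t) = 0 /\ d1 (L t) = 0}.
Proof.
move=> md0 md1 id rz z0.
set F := fun t => _ in id rz.
(* Only the affine combination is known to be integrable; damping by both [d0] and [d1] makes its
   two coefficients bounded, so that they can be treated separately. *)
pose v s := damping (d0 s) * damping (d1 s).
have v_neq0 s : v s != 0 by rewrite mulf_neq0// damping_neq0.
pose w0 s := v s * d0 s; pose w1 s := v s * (d1 s - d0 s).
have mv : measurable_fun [set: SL] v.
  by apply: measurable_funM; exact: measurableT_comp (@measurable_damping R) _.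
have mw0 : measurable_fun [set: SL] w0 by exact: measurable_funM.
have mw1 : measurable_fun [set: SL] w1.
  by apply: measurable_funM => //; exact: measurable_funB.
have w0_le1 s : `|w0 s| <= 1.
  rewrite /w0 /v mulrAC normrM -[leRHS]mulr1 ler_pM//.
  - exact: normr_dampingM.
  - exact: normr_damping.
have w1_le2 s : `|w1 s| <= 1 + 1.
  have -> : w1 s = damping (d0 s) * (damping (d1 s) * d1 s) - w0 s.
    by rewrite /w1 /w0 /v; ring.
  rewrite (le_trans (ler_normB _ _))// lerD// normrM -[leRHS]mulr1 ler_pM//.
  - exact: normr_damping.
  - exact: normr_dampingM.
have v_le1 s : `|v s| <= 1.
  rewrite /v normrM -[leRHS]mulr1 ler_pM//; exact: normr_damping.
have iw0 : L1 (fun t => w0 (L t)).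
  by apply: (@integrable_bounded _ _ _ _ _ 1); [exact: measurable_comp_real|exact: aeW].
have iw1A : L1 (fun t => w1 (L t) * A1 t).
  apply: (@integrable_bounded_mul _ _ _ _ _ _ (1 + 1)) => //.
    exact: measurable_comp_real.
  exact: aeW.
have mvL : measurable_fun [set: SZ * SL] (fun s => v s.2) by exact: measurableT_comp.
have ivF : L1 (fun t => v (L t) * F t).
  apply: (@integrable_bounded_mul _ _ _ _ _ _ 1) => //.
    exact: measurable_comp_real.
  exact: aeW.
have vFE : (fun t => v (L t) * F t) = (fun t => w0 (L t) + w1 (L t) * A1 t).
  by apply/funext => t; rewrite /F /w0 /w1; ring.
have rvF : is_regression P ZL (fun t => w0 (L t) + w1 (L t) * A1 t) (cst 0).
  rewrite -vFE.
  apply: is_regression_ext (is_regressionM mZL id mvL ivF rz) => //.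
  by apply: filterS z0 => t /= ->; rewrite mulr0.
have iwF : L1 (fun t => w0 (L t) + w1 (L t) * A1 t) by exact: integrable_realD.
have rD0 : is_regression P L
    (fun t => D (ZL t) * (w0 (L t) + w1 (L t) * A1 t)) (cst 0).
  have iDF := integrable_centered_weightM iwF.
  have r1 := is_regressionM mZL iwF mD iDF rvF.
  apply/(is_regression_tower _ (@measurable_snd _ _ SZ SL) r1).
  split => //=.
    exact: finite_measure_integrable_cst.
  by move=> B mB; apply: eq_integral => t _; rewrite mulr0.
have iDw1 := integrable_centered_weightM iw1A.
have iw1D : L1 (fun t => w1 (L t) * (D (ZL t) * A1 t)).
  by move: iDw1; under eq_fun do rewrite mulrCA.
have rw1 := is_regressionM mL iDA1 mw1 iw1D rcov.
have rw0 := regression_centered_weightM mw0 iw0.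
have rD1 : is_regression P L
    (fun t => D (ZL t) * (w0 (L t) + w1 (L t) * A1 t)) (fun s => 0 + w1 s * cov s).
  have := is_regressionD mL (integrable_centered_weightM iw0) iw1D rw0 rw1.
  by under eq_fun do rewrite (mulrCA (w1 _)) -mulrDr.
have iDF := integrable_centered_weightM iwF.
have w10 : {ae P, forall t, w1 (L t) = 0}.
  apply: filterS2 cov_neq0 (regression_unique mL iDF rD0 rD1) => t cov0 /= /esym/eqP.
  by rewrite add0r mulf_eq0 (negbTE cov0) orbF => /eqP.
(* Once [w1] vanishes, [w0(L)] alone has zero regression on [(Z, L)]; being a function of [L], it is
   its own regression. *)
have w00 : {ae P, forall t, w0 (L t) = 0}.
  have r1 : is_regression P ZL (fun t => w0 (L t)) (cst 0).
    apply: (is_regression_ae mZL iwF _ _ rvF); first exact: (measurable_comp_real mL).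
    by apply: filterS w10 => t ->; rewrite mul0r addr0.
  have r2 : is_regression P ZL (fun t => w0 (L t)) (fun s => w0 s.2).
    by apply: is_regression_id => //; exact: measurableT_comp.
  exact: (regression_unique mZL iw0 r2 r1).
apply: filterS2 w00 w10 => t /eqP; rewrite mulf_eq0 (negbTE (v_neq0 _)) => /eqP d00.
by move=> /eqP; rewrite mulf_eq0 (negbTE (v_neq0 _)) d00 subr0 => /eqP.
Qed.

(** Write [A1 * X] as [X - A0 * X]. The first term has no covariance with the weight since its
    regression on [(Z, L)] depends on [L] only; in the second [A0 * X] acts like [n * A0], whose
    covariance is [- n * cov]. *)
Lemma cond_cov_treated_outcome (X : T -> R) (m n : SL -> R) : L1 X ->
  measurable_fun [set: SL] n -> L1 (fun t => n (L t) * A0 t) ->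
  is_regression P L X m -> is_regression P ZL X (fun s => m s.2) ->
  is_regression P ZL (fun t => A0 t * X t)
    (fun s => n s.2 * regression P ZL A0 s) ->
  {ae P, forall t, cond_cov P L (fun t => A1 t * X t) pZL t =
                   n (L t) * cond_cov P L A1 pZL t}.
Proof.
move=> iX mn inA0 rm rX rA0X; have [mm im _] := rm.
have iA0X : L1 (fun t => A0 t * X t).
  have := integrable_mul_indic iX E0.
  by under eq_fun do rewrite mulrC.
have A1XE : (fun t => A1 t * X t) = (fun t => X t - A0 t * X t).
  by apply/funext => t; rewrite indic_neqE; ring.
have iA1X : L1 (fun t => A1 t * X t) by rewrite A1XE; exact: integrable_realB.
have rXD : is_regression P L (fun t => D (ZL t) * X t) (cst 0).
  have iDX := integrable_centered_weightM iX.
  have r1 := is_regressionM mZL iX mD iDX rX.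
  apply/(is_regression_tower _ (@measurable_snd _ _ SZ SL) r1).
  exact: regression_centered_weightM.
have mnL : measurable_fun [set: SZ * SL] (fun s => n s.2) by exact: measurableT_comp.
have inD : L1 (fun t => n (L t) * (D (ZL t) * A0 t)).
  have := integrable_centered_weightM inA0.
  by under eq_fun do rewrite mulrCA.
have rA0D : is_regression P L (fun t => D (ZL t) * (A0 t * X t))
    (fun s => n s * (0 - cov s)).
  have rp0 : is_regression P ZL A0 (regression P ZL A0) by exact: regression_exists.
  have rnp0 := is_regressionM mZL iA0 mnL inA0 rp0.
  have r1 := is_regressionM mZL iA0X mD (integrable_centered_weightM iA0X) rA0X.
  have r2 := is_regressionM mZL inA0 mD (integrable_centered_weightM inA0) rnp0.
  (* The tower property is used in both directions: [A0 * X] is replaced by its regression [n * p0],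
     which is then replaced by [n * A0]. *)
  apply/(is_regression_tower _ (@measurable_snd _ _ SZ SL) r1).
  apply/(is_regression_tower _ (@measurable_snd _ _ SZ SL) r2).
  have := is_regressionM mL iDA0 mn inD rcov0.
  by under eq_fun do rewrite mulrCA.
have r1 : is_regression P L (fun t => D (ZL t) * (A1 t * X t))
    (fun s => 0 - n s * (0 - cov s)).
  have -> : (fun t => D (ZL t) * (A1 t * X t)) =
      (fun t => D (ZL t) * X t - D (ZL t) * (A0 t * X t)).
    by apply/funext => t; rewrite indic_neqE; ring.
  exact: (is_regressionB mL (integrable_centered_weightM iX)
    (integrable_centered_weightM iA0X) rXD rA0D).
have r2 := is_regression_cond_cov iA1X.
have := regression_unique mL (integrable_centered_weightM iA1X) r2 r1.
by apply: filterS => t /=; rewrite /cond_cov /cond_exp /= => ->; rewrite /cov; ring.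
Qed.

End weighting.

(** * The solution, its uniqueness and the weighting formula *)

Unset Implicit Arguments.
Set Strict Implicit.
Set Printing Implicit Defensive.

Theorem theoremB1 (R : realType)
    (d : measure_display) (Omega : measurableType d) (P : probability Omega R)
    (M dZ dL : nat) (dU : measure_display) (SU : measurableType dU)
    (supZ : set (dZ.-tuple R)) (supL : set (dL.-tuple R))
    (A : {RV P >-> 'I_M.+1}) (Z : {RV P >-> dZ.-tuple R}) (U : {RV P >-> SU})
    (L : {RV P >-> dL.-tuple R}) (Y : {RV P >-> R})
    (Ypot : 'I_M.+1 -> {RV P >-> R})
    (Z_supZ : forall w, supZ (Z w)) (L_supL : forall w, supL (L w))
    (consistency : {ae P, forall w, Y w = Ypot (A w) w})
    (latent_ignorability : forall a : 'I_M.+1,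
       cond_indep P (fun w => (U w, L w)) (Ypot a) (fun w => (A w, Z w)))
    (iv_independence : cond_indep P L Z U)
    (relevance : iv_relevance P supZ supL A Z L)
    (a : 'I_M.+1)
    (Ya_integrable : P.-integrable [set: Omega] (EFin \o Ypot a))
    (mult_iv : multiplicative_iv P A Z L U a)
    (piw : dZ.-tuple R * dL.-tuple R -> R)
    (piw_regular : regular_weighting P supZ supL A Z L a piw) :
  let Aa : Omega -> R := treated R A a in
  let ZL w := (Z w, L w) in
  let solution (f : bool * dL.-tuple R -> R) :=
    [/\ measurable_fun [set: bool * dL.-tuple R] f,
        P.-integrable [set: Omega] (EFin \o (fun w => f (A w == a, L w))) &
        {ae P, forall w, cond_exp P ZL (fun w => Aa w * Y w) w =
                         cond_exp P ZL (fun w => f (A w == a, L w)) w}] in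
  let psi (p : dZ.-tuple R * dL.-tuple R -> R) w :=
    let pZL w := p (Z w, L w) in
    (1 - Aa w) * (cond_cov P L (fun w => Aa w * Y w) pZL w /
                  cond_cov P L Aa pZL w) + Aa w * Y w in
  (exists f : bool * dL.-tuple R -> R,
    [/\ solution f,
        forall g, solution g ->
          forall i : bool, {ae P, forall w, g (i, L w) = f (i, L w)},
        {ae P, forall w, f (false, L w) =
           cond_exp P L (Ypot a) w -
           cond_exp_on P L [set w | A w <> a] (Ypot a) w} &
        {ae P, forall w, f (true, L w) = cond_exp P L (Ypot a) w}]) /\
  (forall p : dZ.-tuple R * dL.-tuple R -> R,
    regular_weighting P supZ supL A Z L a p ->
    'E_P[Ypot a] = 'E_P[psi p])%E.

Proof.
have mA : measurable_fun [set: Omega] A by [].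
have mZ : measurable_fun [set: Omega] Z by [].
have mU : measurable_fun [set: Omega] U by [].
have mL : measurable_fun [set: Omega] L by [].
have mY : measurable_fun [set: Omega] Y by [].
have ma : measurable [set a] by [].
move=> Aa ZL solution psi.
set X : Omega -> R := Ypot a in Ya_integrable *.
have mX : measurable_fun [set: Omega] X by [].
have mZL : measurable_fun [set: Omega] ZL by exact: measurable_fun_pair.
pose E0 := [set w | A w <> a].
pose A0 : Omega -> R := \1_E0.
have mE0 : measurable E0.
  exact: (measurable_preimage mA (measurableC ma)).
have iA0 : P.-integrable [set: Omega] (EFin \o A0) by exact: integrable_indicR.
have mE1 : measurable [set w | A w = a] by exact: (measurable_preimage mA ma).
have A0E w : A0 w = 1 - Aa w by exact: indic_neqE.
have weightP p : regular_weighting P supZ supL A Z L a p ->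
    [/\ measurable_fun [set: dZ.-tuple R * dL.-tuple R] p,
        exists C, forall w, `|p (Z w, L w)| <= C &
        {ae P, forall w, cond_cov P L Aa (fun w => p (Z w, L w)) w != 0}].
  move=> [mp [C pC] [eps eps0 cov_eps]]; split=> //.
    by exists C => w; exact: pC.
  by apply: filterS cov_eps => w; rewrite -normr_gt0; exact: lt_le_trans.
have [mpi [C piC] cov0] := weightP _ piw_regular.
pose q := regression P L A0.
have q0 : {ae P, forall w, q (L w) != 0}.
  exact: (untreated_neq0 mA mZ mL ma mpi piC cov0).
have rq : is_regression P L A0 q by exact: regression_exists.
pose m := regression P L X.
have rm : is_regression P L X m by exact: regression_exists.
have [mm im _] := rm.
(* This is the pair used by [cond_exp_on], so [n(L)] below is by definition the mean of [Y(a)] given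
   [L] and [A <> a]. *)
pose WE w := (w \in E0, L w).
have mWE : measurable_fun [set: Omega] WE.
  apply: measurable_fun_pair => //; apply: (measurable_fun_bool true).
  rewrite setTI (_ : _ @^-1` _ = E0)//.
  by apply/seteqP; split=> w; [move=> /set_mem|move=> /mem_set].
pose r := regression P WE X.
have rr : is_regression P WE X r by exact: regression_exists.
have [mr _ _] := rr.
pose n l := r (true, l).
have mn : measurable_fun [set: dL.-tuple R] n.
  by apply: (measurableT_comp mr); exact: measurable_fun_pair.
(* Multiplying by this indicator erases the value of [r] at [false], so [phi * r] along [WE] is
   [n(L) * A0]. *)
pose phi (s : bool * dL.-tuple R) : R := if s.1 then 1 else 0.
have mphi : measurable_fun [set: bool * dL.-tuple R] phi.
  by apply: measurable_fun_ifT.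
have phi1 s : `|phi s| <= 1.
  by rewrite /phi; case: s.1; rewrite ?normr1 ?normr0.
have phiE w : phi (WE w) = A0 w by rewrite /phi /A0 indicE /=; case: (w \in E0).
have nA0E : (fun w => phi (WE w) * r (WE w)) = (fun w => n (L w) * A0 w).
  apply/funext => w; rewrite phiE /A0 indicE /n /WE.
  by case: (w \in E0); rewrite ?mul1r ?mulr1 ?mul0r ?mulr0.
have A0XE : (fun w => phi (WE w) * X w) = (fun w => A0 w * X w).
  by apply/funext => w; rewrite phiE.
have rA0X : is_regression P WE (fun w => A0 w * X w) (fun s => phi s * r s).
  rewrite -A0XE; exact: (is_regression_bounded_mul mWE Ya_integrable mphi phi1 rr).
(* Integrability of [n(L) * A0] comes from its being a regression of [A0 * X]; below, [n] enters
   integrals through this product. *)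
have [_ inA0 _] := rA0X; rewrite [X in EFin \o X]nA0E in inA0.
have iA0X : P.-integrable [set: Omega] (EFin \o (fun w => A0 w * X w)).
  have := integrable_mul_indic Ya_integrable mE0.
  by under eq_fun do rewrite mulrC.
have AaXE : (fun w => Aa w * X w) = (fun w => X w - A0 w * X w).
  by apply/funext => w; rewrite A0E; ring.
have iAaX : P.-integrable [set: Omega] (EFin \o (fun w => Aa w * X w)).
  by rewrite AaXE; exact: integrable_realB.
have AaY : {ae P, forall w, Aa w * X w = Aa w * Y w}.
  apply: filterS consistency => w Yw; rewrite /Aa /treated indicE.
  have [Aw|Aw] := boolP (w \in _); last by rewrite !mul0r.
  by move: Aw; rewrite inE /= Yw => ->.
have mAa : measurable_fun [set: Omega] Aa by exact: measurable_indic.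
have mAaY : measurable_fun [set: Omega] (fun w => Aa w * Y w) by exact: measurable_funM.
have iAaY := integrable_real_ae iAaX mAaY AaY.
pose p0 := regression P ZL A0.
have rp0 : is_regression P ZL A0 p0 by exact: regression_exists.
have mnZL : measurable_fun [set: dZ.-tuple R * dL.-tuple R] (fun s => n s.2).
  exact: measurableT_comp.
have rnA0 : is_regression P ZL (fun w => n (L w) * A0 w) (fun s => n s.2 * p0 s).
  exact: (is_regressionM mZL iA0 mnZL inA0 rp0).
have rA0XZL : is_regression P ZL (fun w => A0 w * X w) (fun s => n s.2 * p0 s).
  have [rho [mrho rhoE]] := regression_untreated_outcome mA mZ mL mU ma
    Ya_integrable (latent_ignorability a) iv_independence mult_iv q0.
  pose k := regression P ZL (fun w => A0 w * X w).
  have rk : is_regression P ZL (fun w => A0 w * X w) k by exact: regression_exists.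
  have [mp0 ip0 _] := rp0.
  have mrhop : measurable_fun [set: dZ.-tuple R * dL.-tuple R] (fun s => rho s.2 * p0 s).
    by apply: measurable_funM => //; exact: measurableT_comp.
  have rrho : is_regression P ZL (fun w => A0 w * X w) (fun s => rho s.2 * p0 s).
    exact: (is_regression_ext mZL mrhop rhoE rk).
  have [_ irho _] := rrho.
  (* Both [rho * q] and [n * q] are regressions of [A0 * X] on [L], and [q] can be cancelled. *)
  have rhon : {ae P, forall w, rho (L w) = n (L w)}.
    have rp0q : is_regression P L (fun w => p0 (ZL w)) q.
      exact/(is_regression_tower _ (@measurable_snd _ _ _ _) rp0).
    have r1 : is_regression P L (fun w => A0 w * X w) (fun s => rho s * q s).
      apply/(is_regression_tower _ (@measurable_snd _ _ _ _) rrho).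
      exact: (is_regressionM mL ip0 mrho irho rp0q).
    have r2 : is_regression P L (fun w => A0 w * X w) (fun s => n s * q s).
      apply/(is_regression_tower _ (@measurable_snd _ _ _ _) rA0X).
      rewrite nA0E; exact: (is_regressionM mL iA0 mn inA0 rq).
    apply: filterS2 q0 (regression_unique mL iA0X r1 r2) => w qw.
    exact: mulIf.
  apply: (is_regression_ext mZL _ _ rrho); first exact: measurable_funM.
  by apply: filterS rhon => w /= ->.
have rX : is_regression P ZL X (fun s => m s.2).
  exact: (regression_outcome mA mZ mL mU Ya_integrable (latent_ignorability a)).
(* Along [(A == a, L)] this is [m - n * A0], whose regression on [(Z, L)] is [m - n * p0], the one
   found for [Aa * Y]. *)
pose f (s : bool * dL.-tuple R) := if s.1 then m s.2 else m s.2 - n s.2.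
have mf : measurable_fun [set: bool * dL.-tuple R] f.
  apply: measurable_fun_ifT => //; first exact: measurableT_comp.
  by apply: measurable_funB; exact: measurableT_comp.
have eqE w : Aa w = if A w == a then 1 else 0.
  rewrite /Aa /treated indicE; case: eqP => Aw; first by rewrite mem_set.
  by rewrite memNset.
have fE : (fun w => f (A w == a, L w)) = (fun w => m (L w) - n (L w) * A0 w).
  apply/funext => w; rewrite A0E eqE /f /=.
  by case: (A w == a); rewrite ?subrr ?mulr0 ?subr0 ?mulr1.
have iF : P.-integrable [set: Omega] (EFin \o (fun w => f (A w == a, L w))).
  by rewrite fE; exact: integrable_realB.
have rf : is_regression P ZL (fun w => f (A w == a, L w))
    (fun s => m s.2 - n s.2 * p0 s).
  rewrite fE; apply: (is_regressionB mZL im inA0) rnA0.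
  by apply: is_regression_id => //; exact: measurableT_comp.
have rAaY : is_regression P ZL (fun w => Aa w * Y w)
    (fun s => m s.2 - n s.2 * p0 s).
  apply: (is_regression_ae mZL iAaX mAaY AaY).
  by rewrite AaXE; exact: is_regressionB.
have rAaY' : is_regression P ZL (fun w => Aa w * Y w)
    (regression P ZL (fun w => Aa w * Y w)) by exact: regression_exists.

(* Existence, explicit form and uniqueness *)
split.
  exists f; split.
  - split=> //.
    have rf' := regression_exists mZL iF.
    apply: filterS2 (regression_unique mZL iF rf rf')
      (regression_unique mZL iAaY rAaY rAaY') => w.
    by rewrite /cond_exp /= => -> ->.
  - move=> g [mg ig gE] i.
    (* The difference [g - f] is affine in [Aa] with coefficients depending on [L], the shape
       required by [regression_treated_unique]. *)
    pose d0 l := g (false, l) - f (false, l).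
    pose d1 l := g (true, l) - f (true, l).
    have pm b (h : bool * dL.-tuple R -> R) : measurable_fun setT h ->
        measurable_fun setT (fun l => h (b, l)).
      by move=> mh; apply: (measurableT_comp mh); exact: measurable_fun_pair.
    have md0 : measurable_fun [set: dL.-tuple R] d0.
      by apply: measurable_funB; exact: pm.
    have md1 : measurable_fun [set: dL.-tuple R] d1.
      by apply: measurable_funB; exact: pm.
    have dE : (fun w => g (A w == a, L w) - f (A w == a, L w)) =
        (fun w => d0 (L w) + (d1 (L w) - d0 (L w)) * Aa w).
      apply/funext => w; rewrite eqE /d0 /d1.
      by case: (A w == a); ring.
    have ld : P.-integrable [set: Omega]
        (EFin \o (fun w => d0 (L w) + (d1 (L w) - d0 (L w)) * Aa w)).
      by rewrite -dE; exact: integrable_realB.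
    have rg := regression_exists mZL ig.
    have rd := is_regressionB mZL ig iF rg rf.
    rewrite dE in rd.
    have := regression_treated_unique mA mZ mL ma mpi piC cov0 md0 md1 ld rd.
    have z0 : {ae P, forall w, regression P ZL (fun w => g (A w == a, L w)) (ZL w) -
        (m (ZL w).2 - n (ZL w).2 * p0 (ZL w)) = 0}.
      apply: filterS2 gE (regression_unique mZL iAaY rAaY rAaY') => w.
      by rewrite /cond_exp /= => <- <-; rewrite subrr.
    move=> /(_ z0); apply: filterS => w [/eqP + /eqP].
    by rewrite /d0 /d1 !subr_eq0 => /eqP g0 /eqP g1; case: i.
  - exact: aeW.
  - exact: aeW.

(* The mean of the potential outcome for an arbitrary regular weight *)
move=> p /weightP[mp [Cp pCp] covp0].
have covE : {ae P, forall w,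
    cond_cov P L (fun w => Aa w * Y w) (fun w => p (Z w, L w)) w =
    n (L w) * cond_cov P L Aa (fun w => p (Z w, L w)) w}.
  (* By consistency, multiplying [Aa * X] and [Aa * Y] by the centered weight gives almost surely
     equal variables, so uniqueness of regressions identifies their covariances. *)
  have r1 := is_regression_cond_cov mZ mL mp pCp iAaY.
  have r2 := is_regression_cond_cov mZ mL mp pCp iAaX.
  have iDY := integrable_centered_weightM mZ mL mp pCp iAaY.
  have iDX := integrable_centered_weightM mZ mL mp pCp iAaX.
  have r2' := is_regression_ae mL iDX (integrable_measurable iDY) _ r2.
  have e1 := cond_cov_treated_outcome mA mZ mL ma mp pCp Ya_integrable mn inA0
    rm rX rA0XZL.
  have e2 := regression_unique mL iDY r1 (r2' _).
  apply: filterS2 e1 (e2 _); last first.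
    by apply: filterS AaY => w ->.
  by move=> w <-; exact.
(* The ratio of covariances is [n(L)], as the denominator is almost surely nonzero. *)
have psiE : {ae P, forall w, n (L w) * A0 w + Aa w * X w = psi p w}.
  apply: filterS3 covE covp0 AaY => w cE c0 XY.
  by rewrite /psi cE XY -A0E mulfK// mulrC.
have mcov V W : measurable_fun [set: Omega] (cond_cov P L V W).
  by apply: (measurableT_comp _ mL); exact: measurable_regression.
have mpsi : measurable_fun [set: Omega] (psi p).
  apply: measurable_funD => //; apply: measurable_funM.
    exact: measurable_funB.
  apply: measurable_funM => //.
  by apply: (measurableT_comp (@measurable_invr R)).
have iS := integrable_realD inA0 iAaX.
rewrite unlock -(eq_integral_ae measurableT (integrable_measurable iS) mpsi psiE).
under [RHS]eq_integral do rewrite EFinD.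
rewrite (integralD_EFin measurableT inA0 iAaX)/=.
(* The defining identity of the regression on the whole space: [n(L) * A0] and [A0 * X] have the
   same mean, so the two terms add up to the mean of [X]. *)
have [_ _ /(_ _ measurableT)] := rA0X.
rewrite preimage_setT => e1.
have e2 : (\int[P]_w (n (L w) * A0 w)%:E = \int[P]_w (A0 w * X w)%:E)%E.
  rewrite -e1; apply: eq_integral => w _.
  by have /(congr1 (fun F => F w)) /= -> := nA0E.
rewrite e2 -(integralD_EFin measurableT iA0X iAaX)/=.
apply: eq_integral => w _; rewrite -EFinD; congr EFin.
by rewrite A0E; ring.
Qed.
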